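(* If $X$ is a co-existentially closed continuum that embeds in the plane $\mathbb{R}^2$, then $\check{H}^1(X) = 0$, and hence (any embedded copy of) $X$ does not separate the plane.
   Context: A continuum is a connected compact Hausdorff space. $\check{H}^1$ is first integral Čech cohomology. $C(X)$ denotes the C*-algebra of continuous complex-valued functions on $X$. $T_{\mathrm{conn}}$ denotes a theory of continuous first-order logic in the language of unital C*-algebras whose models are exactly the C*-algebras isomorphic to $C(X)$ for some continuum $X$. A model $M \models T_{\mathrm{conn}}$ is existentially closed if for every $N \models T_{\mathrm{conn}}$ with $M \subseteq N$, every quantifier-free formula $\phi(\overline{x},\overline{y})$ and every tuple $\overline{b}$ from $M$, $(\inf_{\overline{x}}\phi(\overline{x},\overline{b}))^M = (\inf_{\overline{x}}\phi(\overline{x},\overline{b}))^N$. A continuum $X$ is co-existentially closed if $C(X)$ is an existentially closed model of $T_{\mathrm{conn}}$. A subset $X\subseteq\mathbb{R}^2$ separates the plane if $\mathbb{R}^2\setminus X$ is disconnected. *)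

(* Defs.v *)
From HB Require Import structures.
From mathcomp Require Import all_boot all_order all_algebra generic_quotient.
From mathcomp Require Import complex.
From mathcomp Require Import all_classical all_reals all_analysis.
From mathcomp Require Import ring.

Set Implicit Arguments.
Unset Strict Implicit.
Unset Printing Implicit Defensive.

Import Order.TTheory GRing.Theory Num.Theory.
Import numFieldNormedType.Exports.

Local Open Scope ring_scope.
Local Open Scope classical_set_scope.
Local Open Scope quotient_scope.

(* [connected] allows the empty space, whose C(X) is the zero algebra; it embeds
   unitally only into itself, so admitting it as a continuum does not affect
   existential closedness of the other models. *)
Definition continuum (X : topologicalType) : Prop :=
  [/\ connected [set: X], compact [set: X] & hausdorff_space X].

Definition topological_embedding (X Y : topologicalType) (e : X -> Y) : Prop :=
  injective e /\
  forall U : set X, open U <-> exists2 V : set Y, open V & U = e @^-1` V.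

Definition separates_plane (R : realType) (S : set (R * R)%type) : Prop :=
  ~ connected (~` S).

(* Cech H^1 is the direct limit, over all open covers of X ordered by refinement, of the
  first simplicial cohomology with integer coefficients of the nerves.  Covers
  are sets of open sets, indexed by themselves.  Cochains are total functions,
  but only their values on simplices of the nerve (tuples of members with
  nonempty intersection) are ever constrained or compared. *)
Section Cech.
Variable X : topologicalType.
Implicit Types (U V W : set (set X)) (b : set X -> int)
  (c d : set X -> set X -> int) (r s : set X -> set X).

Definition is_open_cover U : Prop :=
  (forall A, U A -> open A) /\ \bigcup_(A in U) A = setT.

Definition is_cocycle U c : Prop := forall A B C, U A -> U B -> U C ->
  A `&` B `&` C !=set0 -> c B C - c A C + c A B = 0.

Definition is_coboundary U c : Prop := exists b, forall A B, U A -> U B ->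
  A `&` B !=set0 -> c A B = b B - b A.

Definition refinement_map W U r : Prop :=
  forall A, W A -> U (r A) /\ A `<=` r A.

Definition pullback r c : set X -> set X -> int := fun A B => c (r A) (r B).

Record cech_cocycle := CechCocycle {
  cocycle_cover : set (set X);
  cocycle_fun : set X -> set X -> int;
  cocycle_coverP : is_open_cover cocycle_cover;
  cocycle_funP : is_cocycle cocycle_cover cocycle_fun }.

HB.instance Definition _ := gen_eqMixin cech_cocycle.
HB.instance Definition _ := gen_choiceMixin cech_cocycle.

Implicit Types x y z : cech_cocycle.

Definition cohomologous x y : Prop := exists W r s,
  [/\ is_open_cover W, refinement_map W (cocycle_cover x) r,
      refinement_map W (cocycle_cover y) s &
      is_coboundary W (pullback r (cocycle_fun x) - pullback s (cocycle_fun y))].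

Lemma cocycle_tri U c A B C : is_cocycle U c -> U A -> U B -> U C ->
  A `&` B `&` C !=set0 -> c A C = c A B + c B C.
Proof.
move=> h ua ub uc abc; apply/eqP; rewrite -subr_eq0 -oppr_eq0.
by apply/eqP; rewrite -(h A B C ua ub uc abc); ring.
Qed.

Lemma refinement_map_comp W V U r s :
  refinement_map W V s -> refinement_map V U r -> refinement_map W U (r \o s).
Proof.
move=> hs hr A /hs[/hr[? h] h']; split => //; exact: subset_trans h' h.
Qed.

Lemma is_coboundaryD U c d :
  is_coboundary U c -> is_coboundary U d -> is_coboundary U (c + d).
Proof.
move=> [b hb] [b' hb']; exists (b + b') => A B uA uB AB.
rewrite !fctE hb// hb'//; ring.
Qed.

Lemma is_coboundaryN U c : is_coboundary U c -> is_coboundary U (- c).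
Proof.
move=> [b hb]; exists (- b) => A B uA uB AB; rewrite !fctE hb//; ring.
Qed.

Lemma is_coboundary0 U : is_coboundary U 0.
Proof. by exists 0 => A B _ _ _; rewrite subr0. Qed.

Lemma is_coboundary_pullback W U r c : refinement_map W U r ->
  is_coboundary U c -> is_coboundary W (pullback r c).
Proof.
move=> hr [b hb]; exists (b \o r) => A B wA wB [x [Ax Bx]].
have [uA sA] := hr _ wA; have [uB sB] := hr _ wB.
by rewrite /pullback hb//; exists x; split; [exact: sA|exact: sB].
Qed.

Lemma is_cocycle_pullback W U r c : refinement_map W U r ->
  is_cocycle U c -> is_cocycle W (pullback r c).
Proof.
move=> hr hc A B C wA wB wC [x [[Ax Bx] Cx]].
have [uA sA] := hr _ wA; have [uB sB] := hr _ wB; have [uC sC] := hr _ wC.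
by apply: hc => //; exists x; split; [split; [exact: sA|exact: sB]|exact: sC].
Qed.

Lemma is_cocycleD U c d : is_cocycle U c -> is_cocycle U d ->
  is_cocycle U (c + d).
Proof.
move=> hc hd A B C uA uB uC ABC.
rewrite !fctE -[RHS]addr0 -{1}(hc A B C)// -(hd A B C)//; ring.
Qed.

Lemma is_cocycleN U c : is_cocycle U c -> is_cocycle U (- c).
Proof.
move=> hc A B C uA uB uC ABC.
rewrite !fctE -[RHS]oppr0 -(hc A B C)//; ring.
Qed.

Lemma is_cocycle0 U : is_cocycle U 0.
Proof. by move=> A B C _ _ _ _; rewrite subr0 addr0. Qed.

Lemma pullback_coboundary W U r s c : is_cocycle U c ->
  refinement_map W U r -> refinement_map W U s ->
  is_coboundary W (pullback r c - pullback s c).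
Proof.
move=> hc hr hs; exists (fun A => c (s A) (r A)) => A B wA wB [x [Ax Bx]].
have [urA rA] := hr _ wA; have [urB rB] := hr _ wB.
have [usA sA] := hs _ wA; have [usB sB] := hs _ wB.
have e1 : c (s A) (r B) = c (s A) (r A) + c (r A) (r B).
  by apply: (cocycle_tri hc) => //; exists x; split; [split|]; auto.
have e2 : c (s A) (r B) = c (s A) (s B) + c (s B) (r B).
  by apply: (cocycle_tri hc) => //; exists x; split; [split|]; auto.
have {}e1 : c (r A) (r B) = c (s A) (r B) - c (s A) (r A).
  by rewrite e1; ring.
rewrite !fctE /pullback e1 e2; ring.
Qed.

(* [represents W x c]: the cochain [c] on the cover [W] has the same class in
   the limit as the cocycle [x]. *)
Definition represents W x c : Prop := is_open_cover W /\
  exists2 r, refinement_map W (cocycle_cover x) r &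
    is_coboundary W (c - pullback r (cocycle_fun x)).

Lemma represents_pullback W V x c r : is_open_cover V ->
  refinement_map V W r -> represents W x c -> represents V x (pullback r c).
Proof.
move=> oV hr [_ [s hs hb]]; split => //; exists (s \o r).
  exact: refinement_map_comp hr hs.
exact: (is_coboundary_pullback hr hb).
Qed.

Lemma represents_coboundary W x c d : represents W x c -> represents W x d ->
  is_coboundary W (c - d).
Proof.
move=> [_ [r hr hc]] [_ [s hs hd]].
have h := pullback_coboundary (@cocycle_funP x) hr hs.
have := is_coboundaryD (is_coboundaryD hc h) (is_coboundaryN hd).
by congr is_coboundary; rewrite addrA subrK opprB addrA subrK.
Qed.

Lemma cohomologousE W x y c : represents W x c -> represents W y c ->
  cohomologous x y.
Proof.
move=> [oW [r hr hc]] [_ [s hs hd]]; exists W, r, s; split => //.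
have := is_coboundaryD hd (is_coboundaryN hc).
congr is_coboundary; rewrite opprB [LHS]addrC addrA; congr (_ - _).
by rewrite subrK.
Qed.

Lemma cohomologousP x y : cohomologous x y ->
  exists W c, represents W x c /\ represents W y c.
Proof.
move=> [W [r [s [oW hr hs hb]]]]; exists W, (pullback r (cocycle_fun x)).
split; split => //; last by exists s.
by exists r => //; rewrite subrr; exact: is_coboundary0.
Qed.

Definition meet_cover U V : set (set X) :=
  [set C | exists A B, [/\ U A, V B & C = A `&` B]].

Lemma meet_coverP U V : is_open_cover U -> is_open_cover V ->
  is_open_cover (meet_cover U V).
Proof.
move=> [oU cU] [oV cV]; split.
  by move=> _ [A [B [uA vB ->]]]; apply: openI; auto.
apply/seteqP; split => // x _.
have [A uA Ax] : (\bigcup_(A in U) A) x by rewrite cU.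
have [B vB Bx] : (\bigcup_(A in V) A) x by rewrite cV.
by exists (A `&` B) => //; exists A, B.
Qed.

Definition meetl U V C : set X :=
  if pselect (exists A, U A /\ C `<=` A) is left h then projT1 (cid h) else set0.

Lemma meetlP U V : refinement_map (meet_cover U V) U (meetl U V).
Proof.
move=> _ [A [B [uA vB ->]]]; rewrite /meetl; case: pselect => [h|[]].
  by case: cid.
by exists A; split => //; exact: subIsetl.
Qed.

Lemma meetrP U V : refinement_map (meet_cover U V) V (meetl V U).
Proof.
move=> _ [A [B [uA vB ->]]]; rewrite /meetl; case: pselect => [h|[]].
  by case: cid.
by exists B; split => //; exact: subIsetr.
Qed.

Lemma represents_self x : represents (cocycle_cover x) x (cocycle_fun x).
Proof.
split; first exact: cocycle_coverP.
exists id; first by move=> A UA; split.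
by rewrite subrr; exact: is_coboundary0.
Qed.

Lemma represents_common W V : is_open_cover W -> is_open_cover V ->
  exists Q r s,
  [/\ is_open_cover Q, refinement_map Q W r & refinement_map Q V s].
Proof.
move=> oW oV; exists (meet_cover W V), (meetl W V), (meetl V W).
by split; [exact: meet_coverP|exact: meetlP|exact: meetrP].
Qed.

Lemma represents_eq W x c d : represents W x c -> is_coboundary W (d - c) ->
  represents W x d.
Proof.
move=> [oW [r hr hc]] hd; split => //; exists r => //.
by have := is_coboundaryD hd hc; rewrite addrA subrK.
Qed.

Lemma cohomologous_refl : reflexive (fun x y => `[< cohomologous x y >]).
Proof.
move=> x; apply/asboolP.
exact: cohomologousE (represents_self x) (represents_self x).
Qed.

Lemma cohomologous_sym : symmetric (fun x y => `[< cohomologous x y >]).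
Proof.
have h x y : cohomologous x y -> cohomologous y x.
  by move=> /cohomologousP[W [c [h1 h2]]]; exact: cohomologousE h2 h1.
by move=> x y; apply/asboolP/asboolP; exact: h.
Qed.

Lemma cohomologous_trans : transitive (fun x y => `[< cohomologous x y >]).
Proof.
move=> y x z /asboolP /cohomologousP[W [c [xc yc]]].
move=> /asboolP /cohomologousP[V [d [yd zd]]]; apply/asboolP.
have [Q [r [s [oQ hr hs]]]] := represents_common xc.1 yd.1.
apply: (cohomologousE (represents_pullback oQ hr xc)).
apply: represents_eq (represents_pullback oQ hs zd) _.
apply: represents_coboundary (represents_pullback oQ hr yc) _.
exact: represents_pullback yd.
Qed.

Definition cohomologous_equiv :=
  EquivRel _ cohomologous_refl cohomologous_sym cohomologous_trans.

Definition cech_H1 : Type := {eq_quot cohomologous_equiv}.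

HB.instance Definition _ := Choice.on cech_H1.
HB.instance Definition _ := EqQuotient.on cech_H1.

Lemma open_coverT : is_open_cover [set setT].
Proof.
split; first by move=> A ->; exact: openT.
by rewrite bigcup_set1.
Qed.

Definition cocycle0 := CechCocycle open_coverT (@is_cocycle0 [set setT]).

Definition cocycleN x :=
  CechCocycle (@cocycle_coverP x) (is_cocycleN (@cocycle_funP x)).

Definition cocycleD x y :=
  let U := cocycle_cover x in let V := cocycle_cover y in
  CechCocycle (meet_coverP (@cocycle_coverP x) (@cocycle_coverP y))
    (is_cocycleD (is_cocycle_pullback (@meetlP U V) (@cocycle_funP x))
                 (is_cocycle_pullback (@meetrP U V) (@cocycle_funP y))).

Lemma represents0 W : is_open_cover W -> represents W cocycle0 0.
Proof.
move=> oW; split => //; exists (fun=> setT) => //.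
by rewrite subr0; exact: is_coboundary0.
Qed.

Lemma representsN W x c : represents W x c -> represents W (cocycleN x) (- c).
Proof.
move=> [oW [r hr hc]]; split => //; exists r => //.
by have := is_coboundaryN hc; rewrite opprD.
Qed.

Lemma representsD W x y c d : represents W x c -> represents W y d ->
  represents W (cocycleD x y) (c + d).
Proof.
move=> [oW [r hr hc]] [_ [s hs hd]]; split => //.
set U := cocycle_cover x in hr; set V := cocycle_cover y in hs.
have ht : refinement_map W (meet_cover U V) (fun A => r A `&` s A).
  move=> A wA; have [uA rA] := hr _ wA; have [vA sA] := hs _ wA.
  by split; [exists (r A), (s A)|move=> z Az; split; auto].
exists (fun A => r A `&` s A) => //.
have h1 := pullback_coboundary (@cocycle_funP x) hr
  (refinement_map_comp ht (@meetlP U V)).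
have h2 := pullback_coboundary (@cocycle_funP y) hs
  (refinement_map_comp ht (@meetrP U V)).
have := is_coboundaryD (is_coboundaryD hc h1) (is_coboundaryD hd h2).
congr is_coboundary; apply/funext => A; apply/funext => B.
by rewrite !fctE /pullback /= -/U -/V !fctE /pullback; ring.
Qed.

Lemma represents3 x y z : exists W c d e,
  [/\ represents W x c, represents W y d & represents W z e].
Proof.
have [Q [r [s [oQ hr hs]]]] :=
  represents_common (@cocycle_coverP x) (@cocycle_coverP y).
have [P [t [u [oP ht hu]]]] := represents_common oQ (@cocycle_coverP z).
have ex w U q : refinement_map U (cocycle_cover w) q -> is_open_cover U ->
    exists c, represents U w c.
  by move=> h oU; eexists; exact: (represents_pullback oU h (represents_self w)).
have [c hc] := ex x _ _ (refinement_map_comp ht hr) oP.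
have [d hd] := ex y _ _ (refinement_map_comp ht hs) oP.
have [e he] := ex z _ _ hu oP.
by exists P, c, d, e.
Qed.

Definition cech_class x : cech_H1 := \pi_cech_H1 x.

Lemma cech_classP x y : cech_class x = cech_class y <-> cohomologous x y.
Proof.
rewrite /cech_class; split; first by move/eqquotP/asboolP.
by move=> h; apply/eqquotP/asboolP.
Qed.

Lemma cech_class_repr (a : cech_H1) : cech_class (repr a) = a.
Proof. exact: reprK. Qed.

Definition H1_zero : cech_H1 := cech_class cocycle0.
Definition H1_opp (a : cech_H1) : cech_H1 := cech_class (cocycleN (repr a)).
Definition H1_add (a b : cech_H1) : cech_H1 :=
  cech_class (cocycleD (repr a) (repr b)).

Lemma H1_oppE x : H1_opp (cech_class x) = cech_class (cocycleN x).
Proof.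
apply/cech_classP.
have /cech_classP/cohomologousP[W [c [h1 h2]]] := cech_class_repr (cech_class x).
exact: cohomologousE (representsN h1) (representsN h2).
Qed.

Lemma H1_addE x y :
  H1_add (cech_class x) (cech_class y) = cech_class (cocycleD x y).
Proof.
apply/cech_classP.
have /cech_classP/cohomologousP[W [c [h1 h2]]] := cech_class_repr (cech_class x).
have /cech_classP/cohomologousP[V [d [k1 k2]]] := cech_class_repr (cech_class y).
have [Q [r [s [oQ hr hs]]]] := represents_common h1.1 k1.1.
apply: cohomologousE (representsD (represents_pullback oQ hr h1)
  (represents_pullback oQ hs k1)) _.
exact: representsD (represents_pullback oQ hr h2) (represents_pullback oQ hs k2).
Qed.

Lemma H1_addA : associative H1_add.
Proof.
move=> a b c; rewrite -(cech_class_repr a) -(cech_class_repr b) -(cech_class_repr c).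
rewrite !H1_addE; apply/cech_classP.
have [W [u [v [w [hu hv hw]]]]] := represents3 (repr a) (repr b) (repr c).
apply: (cohomologousE (representsD hu (representsD hv hw))).
by rewrite addrA; exact: representsD (representsD hu hv) hw.
Qed.

Lemma H1_addC : commutative H1_add.
Proof.
move=> a b; rewrite -(cech_class_repr a) -(cech_class_repr b).
rewrite !H1_addE; apply/cech_classP.
have [W [u [v [_ [hu hv _]]]]] := represents3 (repr a) (repr b) (repr b).
by apply: (cohomologousE (representsD hu hv)); rewrite addrC; exact: representsD.
Qed.

Lemma H1_add0 : left_id H1_zero H1_add.
Proof.
move=> a; rewrite -(cech_class_repr a) H1_addE; apply/cech_classP.
have h := represents_self (repr a).
apply: cohomologousE (representsD (represents0 h.1) h) _.
by rewrite add0r.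
Qed.

Lemma H1_addN : left_inverse H1_zero H1_opp H1_add.
Proof.
move=> a; rewrite -(cech_class_repr a) H1_oppE H1_addE; apply/cech_classP.
have h := represents_self (repr a).
apply: cohomologousE (representsD (representsN h) h) _.
by rewrite addNr; exact: represents0 h.1.
Qed.

HB.instance Definition _ :=
  GRing.isZmodule.Build cech_H1 H1_addA H1_addC H1_add0 H1_addN.

End Cech.

(* A structure interprets the function symbols of the language of unital
  C*-algebras; its metric is
  [norm (x - y)] and its domains of quantification are the closed balls of
  radius a natural number.  No axioms are imposed here, since below only
  structures isomorphic to some C(Y) are ever considered as models. *)
Record cstar_structure (R : realType) := CstarStructure {
  carrier :> Type;
  cs_zero : carrier;
  cs_one : carrier;
  cs_add : carrier -> carrier -> carrier;
  cs_mul : carrier -> carrier -> carrier;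
  cs_star : carrier -> carrier;
  cs_scale : R[i] -> carrier -> carrier;
  cs_norm : carrier -> R }.

Definition cstar_embedding (R : realType) (M N : cstar_structure R)
    (j : M -> N) : Prop :=
  injective j /\
  [/\ j (cs_zero M) = cs_zero N,
      j (cs_one M) = cs_one N,
      {morph j : x y / cs_add x y},
      {morph j : x y / cs_mul x y} &
      [/\ {morph j : x / cs_star x},
          forall a, {morph j : x / cs_scale a x} &
          forall x, cs_norm (j x) = cs_norm x]].

Definition cstar_isomorphic (R : realType) (M N : cstar_structure R) : Prop :=
  exists2 j : M -> N, cstar_embedding j & bijective j.

Section ContinuousFunctions.
Variables (R : realType) (X : topologicalType).
(* the regular module [R[i]^o] carries the metric topology of the modulus *)
Local Notation C := (R[i]^o).
Local Notation CX := (continuousType X C).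
Implicit Types f g : CX.

Lemma cf_add_cts f g : continuous (fun x => f x + g x : C).
Proof. by move=> x; apply: cvgD; exact: cts_fun. Qed.

Lemma cf_mul_cts f g : continuous (fun x => (f x : R[i]) * g x : C).
Proof. by move=> x; apply: (@cvgM R[i]); exact: cts_fun. Qed.

Lemma conjc_continuous : continuous (@conjc R : C -> C).
Proof.
move=> z; apply/(@cvgrPdist_lt R[i] C C (nbhs z) _ conjc (conjc z)) => e e0.
near=> w.
have -> : conjc z - conjc w = conjc (z - w :> R[i]) by rewrite rmorphB.
have -> : `|conjc (z - w :> R[i]) : C| = `|z - w : C|.
  by rewrite !normc_def; case: (z - w :> R[i]) => a b /=; rewrite sqrrN.
by near: w; exists e.
Unshelve. all: by end_near. Qed.

Lemma cf_star_cts f : continuous (fun x => conjc (f x) : C).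
Proof.
move=> x; apply: (@continuous_comp X C C); first exact: cts_fun.
exact: conjc_continuous.
Qed.

Lemma cf_scale_cts (a : R[i]) f : continuous (fun x => a * (f x : R[i]) : C).
Proof. by move=> x; apply: (@cvgM R[i]); [exact: cvg_cst|exact: cts_fun]. Qed.

Lemma cf_cst_cts (a : R[i]) : continuous (fun _ : X => a : C).
Proof. by move=> x; exact: cvg_cst. Qed.

Definition CX_structure : cstar_structure R :=
  @CstarStructure R CX
    (mkcts (@cf_cst_cts 0))
    (mkcts (@cf_cst_cts 1))
    (fun f g => mkcts (@cf_add_cts f g))
    (fun f g => mkcts (@cf_mul_cts f g))
    (fun f => mkcts (@cf_star_cts f))
    (fun a f => mkcts (@cf_scale_cts a f))
    (fun f => sup (range (fun x => Normc.normc (f x)))).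

End ContinuousFunctions.

(* Only the class of models of the theory matters for existential closedness. *)
Definition Tconn_model (R : realType) (M : cstar_structure R) : Prop :=
  exists2 Y : topologicalType, continuum Y &
    cstar_isomorphic M (CX_structure R Y).

Inductive cstar_term (R : realType) (V : Type) : Type :=
| TVar of V
| TZero
| TOne
| TAdd of cstar_term R V & cstar_term R V
| TMul of cstar_term R V & cstar_term R V
| TStar of cstar_term R V
| TScale of R[i] & cstar_term R V.

Inductive qf_formula (R : realType) (V : Type) : Type :=
(* connectives are all continuous functions R^n -> R; atomic formulas are norms
   of *-polynomials, which include the distances |s - t| *)
| FNorm of cstar_term R V
| FConn (n : nat) (u : 'rV[R]_n -> R) of continuous u &
    ('I_n -> qf_formula R V).

Fixpoint term_val (R : realType) (M : cstar_structure R) (V : Type)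
    (v : V -> M) (t : cstar_term R V) : M :=
  match t with
  | TVar i => v i
  | TZero => cs_zero M
  | TOne => cs_one M
  | TAdd s t => cs_add (term_val v s) (term_val v t)
  | TMul s t => cs_mul (term_val v s) (term_val v t)
  | TStar t => cs_star (term_val v t)
  | TScale a t => cs_scale a (term_val v t)
  end.

Fixpoint formula_val (R : realType) (M : cstar_structure R) (V : Type)
    (v : V -> M) (phi : qf_formula R V) : R :=
  match phi with
  | FNorm t => cs_norm (term_val v t)
  | FConn n u _ psi => u (\row_i formula_val v (psi i))
  end.

Definition join_val (M : Type) (n m : nat) (x : 'I_n -> M) (b : 'I_m -> M)
    (i : 'I_n + 'I_m) : M :=
  match i with inl k => x k | inr k => b k end.

(* The value in M of inf_x phi(x, b), where x_i ranges over the ball of radius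
   [k i].  For models of [Tconn_model] phi is bounded on these balls; taking the
   infimum in [\bar R] avoids any convention for unbounded sets. *)
Definition inf_val (R : realType) (M : cstar_structure R) (n m : nat)
    (k : 'I_n -> nat) (phi : qf_formula R ('I_n + 'I_m)) (b : 'I_m -> M)
    : \bar R :=
  ereal_inf [set (formula_val (join_val x b) phi)%:E |
             x in [set x : 'I_n -> M | forall i, cs_norm (x i) <= (k i)%:R]].

(* The inclusion of a submodel M of N is presented as an embedding j. *)
Definition existentially_closed (R : realType) (M : cstar_structure R) : Prop :=
  Tconn_model M /\
  forall (N : cstar_structure R) (j : M -> N),
    Tconn_model N -> cstar_embedding j ->
    forall (n m : nat) (k : 'I_n -> nat) (phi : qf_formula R ('I_n + 'I_m))
      (b : 'I_m -> M),
    inf_val k phi b = inf_val k phi (j \o b).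

Definition co_existentially_closed (R : realType) (X : topologicalType) : Prop :=
  continuum X /\ existentially_closed (CX_structure R X).

(* Main.v *)
(* Write K for the range of an embedding e of X in the plane.

   Existential closedness provides approximate square roots: for u in C(X), the
   double cover Y = {(x, w) : w ^ 2 = u x} is either trivial, and then u has a
   square root in C(X), or a continuum whose function algebra extends C(X) and
   contains a square root of u; so inf_w |w ^ 2 - u| = 0 in C(X).

   If p lies in a bounded component D of the complement of K, apply this to
   u = e - p.  On a fine square grid, the signs of w relative to a fixed branch of
   the square root form a mod 2 function near K whose coboundary is the
   monodromy cochain of the double cover z -> z ^ 2 + p.  Using this coboundary
   inside D, and the monodromy cochain elsewhere, gives a cochain that is closed,
   hence exact, on the whole grid, but has nonzero period along a large loop.
   So the complement of K is connected.

   Finally, a Cech cocycle of X yields an integer 1-cochain of a fine grid, closed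
   near K.  The complement of K being connected, the residues at the other squares
   can be pushed to infinity along squares missing K.  The resulting cochain is
   closed on the whole grid, hence exact, and a potential for it trivializes the
   cocycle on the cover by the open stars of the vertices. *)
Require Import Defs.
From mathcomp Require Import all_boot all_order all_algebra.
From mathcomp Require Import complex.
From mathcomp Require Import all_classical all_reals all_analysis.
From mathcomp Require Import ring lra zify.
Import Order.TTheory GRing.Theory Num.Theory numFieldNormedType.Exports.
Local Open Scope ring_scope.
Local Open Scope classical_set_scope.

Set Implicit Arguments.
Unset Strict Implicit.
Unset Printing Implicit Defensive.

(** * Cochains of the square grid *)

Lemma int_step_ind (P : int -> Prop) (a : int) : P a ->
  (forall i, P i <-> P (i + 1)) -> forall i, P i.
Proof.
move=> Pa st.
have up (k : nat) : P (a + k%:Z).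
  elim: k => [|k IH]; first by rewrite addr0.
  by have /st := IH; congr P; lia.
have dn (k : nat) : P (a - k%:Z).
  elim: k => [|k IH]; first by rewrite subr0.
  by apply/st; move: IH; congr P; lia.
move=> i; have [ai|ia] := lerP a i.
  by have := up `|i - a|%N; congr P; lia.
by have := dn `|a - i|%N; congr P; lia.
Qed.

Lemma int_step_eq (T : Type) (f : int -> T) :
  (forall i, f (i + 1) = f i) -> forall i j, f i = f j.
Proof.
move=> st i j; apply: (int_step_ind (P := fun i => f i = f j) (a := j)) => // k.
by rewrite st.
Qed.

Section GridCochains.
Variable G : comNzRingType.
Implicit Types h v : int -> int -> G.

Lemma int_antidifference (f : int -> G) :
  exists F : int -> G, forall i, F (i + 1) = F i + f i.
Proof.
exists (fun i => match i with
  | Posz n => \sum_(k < n) f k%:Z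
  | Negz n => - \sum_(k < n.+1) f (- k.+1%:Z) end).
case=> [n|n].
  have -> : (Posz n + 1 = Posz n.+1)%R by lia.
  by rewrite big_ord_recr.
case: n => [|n].
  have -> : (Negz 0 + 1 = Posz 0)%R by lia.
  by rewrite big_ord_recl !big_ord0 addr0 NegzE addNr.
have -> : (Negz n.+1 + 1 = Negz n)%R by lia.
by rewrite [in RHS]big_ord_recr /= opprD -addrA NegzE addNr addr0.
Qed.

(* A 1-cochain of the grid Z^2 is a pair (h, v): h i j sits on the edge from
   (i, j) to (i + 1, j) and v i j on the edge from (i, j) to (i, j + 1). *)
Definition curl h v (i j : int) : G := h i j + v (i + 1) j - h i (j + 1) - v i j.

(** Integrate along the row at height 0, then up every column. The vertical equations hold by
    construction, and vanishing curl carries the horizontal ones from height 0 to all heights. *)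
Lemma curl_free_exact h v : (forall i j, curl h v i j = 0) ->
  exists b : int -> int -> G, forall i j,
    b (i + 1) j = b i j + h i j /\ b i (j + 1) = b i j + v i j.
Proof.
move=> hv0.
have [H Hh] := int_antidifference (h ^~ 0).
have [V Vv] := choice (fun i => int_antidifference (v i)).
exists (fun i j => H i + V i j - V i 0) => i j; split; last by rewrite Vv; ring.
pose b j := H (i + 1) + V (i + 1) j - V (i + 1) 0 - (H i + V i j - V i 0 + h i j).
suff : b j = b 0 by rewrite /b Hh => /eqP; rewrite -subr_eq0 => /eqP e;
  apply/eqP; rewrite -subr_eq0 -e; apply/eqP; ring.
apply: int_step_eq => k; rewrite /b !Vv -[RHS]addr0 -(hv0 i k) /curl; ring.
Qed.

Lemma curlD h v h' v' i j :
  curl (h + h') (v + v') i j = curl h v i j + curl h' v' i j.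
Proof. by rewrite /curl !fctE; ring. Qed.

Variable T : int -> int -> Prop.

(* The squares whose residue can be pushed to infinity, along the row to the right
   or from square to square, without changing an edge of a square in T. *)
Inductive escapes (i j : int) : Prop :=
| escapes_right of (forall k : int, i <= k -> ~ T k j)
| escapes_step i' j' of ~ T i j & `|i - i'| + `|j - j'| = 1 & escapes i' j'.

Lemma escapesN i j : escapes i j -> ~ T i j.
Proof. by case=> // h; exact: h. Qed.

Lemma escapes_rectangle (a b c d i j i' j' : int) :
  (forall k l : int, a <= k <= b -> c <= l <= d -> ~ T k l) ->
  a <= i <= b -> a <= i' <= b -> c <= j <= d -> c <= j' <= d ->
  escapes i' j' -> escapes i j.
Proof.
move=> nT hi hi' hj hj' es.
have {}es : escapes i j'.
  have [m] := ubnP `|i - i'|%N; elim: m i hi => // m IH i hi him.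
  have [->//|ne] := eqVneq i i'.
  have [lt|le] := ltrP i i'.
    by apply: (@escapes_step _ _ (i + 1) j'); [apply: nT|lia|apply: IH; lia].
  by apply: (@escapes_step _ _ (i - 1) j'); [apply: nT|lia|apply: IH; lia].
have [m] := ubnP `|j - j'|%N; elim: m j hj => // m IH j hj him.
have [->//|ne] := eqVneq j j'.
have [lt|le] := ltrP j j'.
  by apply: (@escapes_step _ _ i (j + 1)); [apply: nT|lia|apply: IH; lia].
by apply: (@escapes_step _ _ i (j - 1)); [apply: nT|lia|apply: IH; lia].
Qed.

Definition vanishes_on_edges h v := forall i j, T i j ->
  [/\ h i j = 0, h i (j + 1) = 0, v i j = 0 & v (i + 1) j = 0].

Lemma vanishes_on_edgesD h v h' v' : vanishes_on_edges h v ->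
  vanishes_on_edges h' v' -> vanishes_on_edges (h + h') (v + v').
Proof.
move=> hv hv' i j Tij; rewrite !fctE.
have [-> -> -> ->] := hv _ _ Tij; have [-> -> -> ->] := hv' _ _ Tij.
by rewrite addr0.
Qed.

Let dirac (i j : int) (t : G) : int -> int -> G :=
  fun k l => if (k == i) && (l == j) then t else 0.

Lemma curl_transfer i j i' j' (t : G) : ~ T i j -> ~ T i' j' ->
  `|i - i'| + `|j - j'| = 1 ->
  exists h v, vanishes_on_edges h v /\ forall k l,
    curl h v k l = dirac i j t k l - dirac i' j' t k l.
Proof.
move=> nT nT'; have d0 p q s k l : ~ (k = p /\ l = q) -> dirac p q s k l = 0.
  by move=> n; rewrite /dirac; case: eqP => //= kp; case: eqP => // lq; case: n.
move=> ad.
have : [\/ i' = i + 1 /\ j' = j, i' = i - 1 /\ j' = j,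
  i' = i /\ j' = j + 1 | i' = i /\ j' = j - 1].
  have [?|?|?|?] : [\/ i' = i + 1, i' = i - 1, j' = j + 1 | j' = j - 1].
  - have [|] := eqVneq i' (i + 1); first by constructor 1.
    have [|] := eqVneq i' (i - 1); first by constructor 2.
    have [|] := eqVneq j' (j + 1); first by constructor 3.
    by constructor 4; lia.
  - by constructor 1; lia.
  - by constructor 2; lia.
  - by constructor 3; lia.
  - by constructor 4; lia.
case=> -[? ?]; subst i' j'.
- exists (fun _ _ => 0), (dirac (i + 1) j t); split.
    by move=> k l kl; split => //; apply: d0 => -[? ?]; subst;
      [exact: nT'|apply: nT; move: kl; congr T; lia].
  move=> k l; rewrite /curl /dirac (inj_eq (addIr 1)).
  by case: ifP; case: ifP => *; ring.
- exists (fun _ _ => 0), (dirac i j (- t)); split.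
    by move=> k l kl; split => //; apply: d0 => -[? ?]; subst;
      [exact: nT|apply: nT'; move: kl; congr T; lia].
  move=> k l; rewrite /curl /dirac -[k == i - 1](inj_eq (addIr 1)) subrK.
  by case: ifP; case: ifP => *; ring.
- exists (dirac i (j + 1) (- t)), (fun _ _ => 0); split.
    by move=> k l kl; split => //; apply: d0 => -[? ?]; subst;
      [exact: nT'|apply: nT; move: kl; congr T; lia].
  move=> k l; rewrite /curl /dirac (inj_eq (addIr 1)).
  by case: ifP; case: ifP => *; ring.
- exists (dirac i j t), (fun _ _ => 0); split.
    by move=> k l kl; split => //; apply: d0 => -[? ?]; subst;
      [exact: nT|apply: nT'; move: kl; congr T; lia].
  move=> k l; rewrite /curl /dirac -[l == j - 1](inj_eq (addIr 1)) subrK.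
  by case: ifP; case: ifP => *; ring.
Qed.

Lemma escapes_residue i j : escapes i j -> forall t : G,
  exists h v, vanishes_on_edges h v /\ forall k l, curl h v k l = dirac i j t k l.
Proof.
elim=> {i j} [i j nT|i j i' j' nT ad es IH] t.
  (* The value [t] on every vertical edge of row [j] to the right of the square: in the squares
     beyond [(i, j)] the two vertical edges cancel. *)
  exists (fun _ _ => 0), (fun k l => if (i < k) && (l == j) then t else 0); split.
    move=> k l kl; split => //; case: ifP => // /andP[ik /eqP ?]; subst l.
      by case: (nT k) => //; lia.
    by case: (nT k) => //; lia.
  move=> k l; rewrite /curl /dirac.
  case: (eqVneq l j) => _; last by rewrite !andbF; ring.
  rewrite !andbT; case: (ltgtP i k) => [ik|ki|->].
  - by rewrite (_ : i < k + 1); [ring|lia].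
  - by rewrite (_ : i < k + 1 = false); [ring|lia].
  - by rewrite (_ : k < k + 1); [ring|lia].
have [h [v [hv cv]]] := IH t.
have [h' [v' [hv' cv']]] := curl_transfer t nT (escapesN es) ad.
exists (h + h'), (v + v'); split; first exact: vanishes_on_edgesD.
by move=> k l; rewrite curlD cv cv'; ring.
Qed.

(** Residues are cancelled one square at a time; that they all lie in the list [s] makes this a
    finite process. *)
Lemma escapes_all_exact (s : seq (int * int)) h v :
  (forall i j, curl h v i j != 0 -> (i, j) \in s /\ escapes i j) ->
  exists h' v', vanishes_on_edges h' v' /\
    forall i j, curl (h + h') (v + v') i j = 0.
Proof.
elim: s h v => [|[i j] s IH] h v hv.
  exists 0, 0; split => // i j; rewrite !addr0.
  by apply: contrapT => /eqP /hv[].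
have [c0|c0] := eqVneq (curl h v i j) 0.
  apply: IH => k l kl; have [] := hv _ _ kl; rewrite inE => /orP[/eqP[? ?]|//].
  by subst; rewrite c0 eqxx in kl.
have [_ es] := hv _ _ c0.
have [h1 [v1 [hv1 cv1]]] := escapes_residue es (- curl h v i j).
have [|h2 [v2 [hv2 cv2]]] := IH (h + h1) (v + v1).
  move=> k l; rewrite curlD cv1 /dirac.
  case: ifP => [/andP[/eqP-> /eqP->]|n]; first by rewrite subrr eqxx.
  by rewrite addr0 => /hv[]; rewrite inE xpair_eqE n.
exists (h1 + h2), (v1 + v2); split; first exact: vanishes_on_edgesD.
by move=> k l; rewrite !addrA.
Qed.

End GridCochains.

(** * Compact sets in the plane *)

Lemma hausdorff_prod (S T : topologicalType) :
  hausdorff_space S -> hausdorff_space T -> hausdorff_space (S * T)%type.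
Proof.
move=> hS hT [a b] [a' b'] xy; congr (_, _).
  apply: hS => U V Ua Va'.
  have [||[c d] [/= Uc Vc]] := xy (fst @^-1` U) (fst @^-1` V); last by exists c.
    exact: (@cvg_fst _ _ (nbhs a) (nbhs b)).
  exact: (@cvg_fst _ _ (nbhs a') (nbhs b')).
apply: hT => U V Ub Vb'.
have [||[c d] [/= Ud Vd]] := xy (snd @^-1` U) (snd @^-1` V); last by exists d.
  exact: (@cvg_snd _ _ (nbhs a) (nbhs b)).
exact: (@cvg_snd _ _ (nbhs a') (nbhs b')).
Qed.

Lemma continuous_bounded (R : realType) (X : topologicalType) (f : X -> R) :
  compact [set: X] -> continuous f -> exists M, forall x, `|f x| <= M.
Proof.
move=> cX cf.
have [M [_ Mb]] := compact_bounded (continuous_compact (continuous_subspaceT cf) cX).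
exists (M + 1) => x; apply: (Mb (M + 1)); first by rewrite ltrDl.
by exists x.
Qed.

Lemma plane_ballP (R : realType) (a b : R * R) (r : R) : ball a r b <->
  [/\ a.1 - r < b.1, b.1 < a.1 + r, a.2 - r < b.2 & b.2 < a.2 + r].
Proof.
rewrite /ball /= /prod_ball /ball /= !ltr_distlC.
by split=> [[/andP[? ?] /andP[? ?]]|[-> -> -> ->]].
Qed.

Definition mesh_floor (R : realType) (d z : R) : int := Num.floor (z / d).

Lemma mesh_floorP (R : realType) (d z : R) : 0 < d ->
  (mesh_floor d z)%:~R * d <= z < (mesh_floor d z)%:~R * d + d.
Proof.
move=> d0; have /andP[h1 h2] := floor_itv (z / d).
by rewrite -ler_pdivlMr// h1/= -[X in _ + X]mul1r -mulrDl -ltr_pdivrMr// -intrD1.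
Qed.

Lemma mesh_floor_int (R : realType) (d : R) (i : int) : 0 < d ->
  mesh_floor d (i%:~R * d) = i.
Proof. by move=> d0; rewrite /mesh_floor mulfK ?gt_eqF// intrKfloor. Qed.

Lemma mesh_lt (R : realType) (d : R) (i j : int) : 0 < d ->
  i%:~R * d < j%:~R * d -> i < j.
Proof. by move=> d0; rewrite ltr_pM2r// ltr_int. Qed.

Lemma mesh_le (R : realType) (d : R) (i j : int) : 0 < d ->
  i <= j -> i%:~R * d <= j%:~R * d.
Proof. by move=> d0 ij; rewrite ler_pM2r// ler_int. Qed.

Lemma mesh_between (R : realType) (d p q : R) (a b k : int) : 0 < d ->
  p < a%:~R * d -> p < b%:~R * d -> a%:~R * d < q -> b%:~R * d < q ->
  Num.min a b <= k <= Num.max a b -> p < k%:~R * d < q.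
Proof.
move=> d0 ha hb ha' hb' /andP[]; rewrite ge_min le_max.
by move=> /orP[] /(mesh_le d0) ? /orP[] /(mesh_le d0) ?; apply/andP; split; lra.
Qed.

Section PlanarCompacta.
Variables (R : realType) (X : topologicalType) (e : X -> (R * R)%type).
Hypotheses (cX : compact [set: X]) (he : topological_embedding e).

Lemma embedding_open_ball (A : set X) x : open A -> A x ->
  exists2 r : R, 0 < r & forall x', ball (e x) r (e x') -> A x'.
Proof.
move=> /he.2[V oV ->] Vx.
have /nbhs_ballP[r r0 rV] : nbhs (e x) V by exact: open_nbhs_nbhs.
by exists r => // x'; exact: rV.
Qed.

(** The near-covering form of compactness turns a radius that works locally around each point into
    one that works everywhere. *)
Lemma lebesgue_number (W : set (set X)) : is_open_cover W ->
  exists2 d : R, 0 < d &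
    forall x, exists2 A, W A & forall x', ball (e x) d (e x') -> A x'.
Proof.
move=> [oW cW].
have /compact_near_coveringP/(_ R (0^'+)
  (fun d x => exists2 A, W A & forall x', ball (e x) d (e x') -> A x')) := cX.
case.
  move=> x _; have [A WA Ax] : (\bigcup_(A in W) A) x by rewrite cW.
  have [r r0 rA] := embedding_open_ball (oW _ WA) Ax.
  have [s s0 sA] : exists2 s : R, 0 < s &
      nbhs x [set x' | ball (e x) s (e x')] /\ s + s = r.
    exists (r / 2); first by rewrite divr_gt0.
    split; last by rewrite -splitr.
    apply: open_nbhs_nbhs; split; last by apply: ballxx; rewrite divr_gt0.
    have -> : [set x' | ball (e x) (r / 2) (e x')] = e @^-1` (ball (e x) (r / 2)) by [].
    by apply/he.2; exists (ball (e x) (r / 2)) => //; exact: ball_open.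
  case: sA => sA rE.
  exists ([set x' | ball (e x) s (e x')], [set t | t < s]) => /=.
    by split => //=; exact: nbhs_right_lt.
  move=> [x' t] /= [h ts]; exists A => // x'' h'; apply: rA; rewrite -rE.
  apply: ball_triangle h _; exact: le_ball (ltW ts) _ h'.
move=> d0 /= [d0p h].
exists (d0 / 2); first by rewrite divr_gt0.
move=> x; apply: (h (d0 / 2)) => //=.
  by rewrite sub0r normrN gtr0_norm ?divr_gt0// ltr_pdivrMr// ltr_pMr// ltr1n.
by rewrite divr_gt0.
Qed.

Lemma embedding_continuous : continuous e.
Proof. by apply/continuousP => V oV; apply/he.2; exists V. Qed.

Lemma embedding_uniform_continuity (f : X -> R) : continuous f ->
  forall t : R, 0 < t -> exists2 d : R, 0 < d &
    forall x x', ball (e x) d (e x') -> `|f x - f x'| < t.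
Proof.
move=> cf t t0.
have [|d d0 h] := @lebesgue_number [set f @^-1` ball y (t / 2) | y in setT].
  split; first by move=> _ [y _ <-]; apply: open_comp => //; exact: ball_open.
  apply/seteqP; split => // x _; exists (f @^-1` ball (f x) (t / 2)).
    by exists (f x).
  by apply: ballxx; rewrite divr_gt0.
exists d => // x x' xx'; have [_ [y _ <-] hy] := h x.
have h1 := hy x (ballxx _ d0); have h2 := hy x' xx'.
exact: (ball_splitr h1 h2).
Qed.

(** * Escape of grid squares from a planar compactum *)

Definition touches (d : R) (i j : int) : Prop := exists x,
  [/\ i%:~R * d <= (e x).1, (e x).1 <= i%:~R * d + d,
      j%:~R * d <= (e x).2 & (e x).2 <= j%:~R * d + d].

Lemma embedding_bounded : exists2 M : R, 0 <= M & forall x,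
  [/\ - M <= (e x).1, (e x).1 <= M, - M <= (e x).2 & (e x).2 <= M].
Proof.
have [|M1 h1] := continuous_bounded (f := fst \o e) cX.
  by move=> x; apply: continuous_comp; [exact: embedding_continuous|exact: cvg_fst].
have [|M2 h2] := continuous_bounded (f := snd \o e) cX.
  by move=> x; apply: continuous_comp; [exact: embedding_continuous|exact: cvg_snd].
exists (`|M1| + `|M2|); first by rewrite addr_ge0.
move=> x; have := h1 x; have := h2 x; rewrite /= !ler_norml.
have := ler_norm M1; have := ler_norm M2.
have := normr_ge0 M1; have := normr_ge0 M2.
by move=> ? ? ? ? /andP[? ?] /andP[? ?]; split; lra.
Qed.

Lemma range_closed : closed (range e).
Proof.
apply: compact_closed; first by apply: hausdorff_prod; exact: Rhausdorff.
apply: continuous_compact cX; apply: continuous_subspaceT.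
exact: embedding_continuous.
Qed.

(** Asking this for all small meshes and all nearby points makes the resulting condition on [y] open
    and suited to compactness. *)
Definition mesh_escapes (r : R) (y : R * R) : Prop := forall d : R, 0 < d < r ->
  forall z, ball y r z ->
  escapes (touches d) (mesh_floor d z.1) (mesh_floor d z.2).

(** Within the connected complement, the points with such a radius form a nonempty, open and
    relatively closed set. *)
Lemma complement_mesh_escapes : connected (~` range e) ->
  forall y, (~` range e) y -> exists2 r : R, 0 < r & mesh_escapes r y.
Proof.
move=> cK; pose O := [set y | exists2 r : R, 0 < r & mesh_escapes r y].
suff : ~` range e `&` O = ~` range e by move=> h y; rewrite -h => -[].
have [M M0 Me] := embedding_bounded.
apply: cK.
- exists (M + 2, 0); split; first by move=> [x _ ex]; have [] := Me x; rewrite ex /=; lra.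
  exists 1 => // d /andP[d0 d1] z /plane_ballP /= [z1 z1' z2 z2'].
  apply: escapes_right => k ik [x [h1 h2 h3 h4]].
  have [_ m _ _] := Me x; have := mesh_le d0 ik.
  have /andP[_ ] := mesh_floorP z.1 d0; lra.
- exists O => //; rewrite openE => y [r r0 hr].
  apply/nbhs_ballP; exists (r / 2); first by rewrite /= divr_gt0.
  move=> y' yy'; exists (r / 2); first by rewrite divr_gt0.
  move=> d /andP[d0 dr] z hz; apply: hr; first by rewrite d0; lra.
  by have := ball_triangle yy' hz; rewrite -splitr.
- exists (closure O); first exact: closed_closure.
  apply/seteqP; split => [y [Ky Oy]|y [Ky cOy]].
    by split => //; exact: subset_closure.
  split => //.
  have /nbhs_ballP[s /= s0 sK] : nbhs y (~` range e).
    by apply: open_nbhs_nbhs; split => //; rewrite openC; exact: range_closed.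
  have s4 : 0 < s / 4 by rewrite divr_gt0.
  have [y' [[r' r0 hr'] yy']] := cOy _ (nbhsx_ballx y (s / 4) s4).
  exists (Num.min r' (s / 4)); first by rewrite lt_min r0.
  move=> d /andP[d0]; rewrite lt_min => /andP[dr' ds] z hz.
  have {}hz : ball y (s / 4) z by apply: le_ball hz; rewrite ge_min lexx orbT.
  have es : escapes (touches d) (mesh_floor d y'.1) (mesh_floor d y'.2).
    by apply: hr'; [rewrite d0|exact: ballxx].
  have [y1 y1' y2 y2'] := (plane_ballP _ _ _).1 yy'.
  have [z1 z1' z2 z2'] := (plane_ballP _ _ _).1 hz.
  have /andP[fy1 fy1'] := mesh_floorP y'.1 d0.
  have /andP[fy2 fy2'] := mesh_floorP y'.2 d0.
  have /andP[fz1 fz1'] := mesh_floorP z.1 d0.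
  have /andP[fz2 fz2'] := mesh_floorP z.2 d0.
  move: fy1 fy1' fy2 fy2' fz1 fz1' fz2 fz2' es.
  set i := mesh_floor d z.1; set j := mesh_floor d z.2.
  set i' := mesh_floor d y'.1; set j' := mesh_floor d y'.2.
  move=> fy1 fy1' fy2 fy2' fz1 fz1' fz2 fz2' es.
  (* The lower left corners of these squares are within [s / 2] of [y] and the side is below
     [s / 4], so the rectangle stays in the ball of radius [s], which misses the compactum. *)
  apply: (@escapes_rectangle _ (Num.min i i') (Num.max i i') (Num.min j j')
    (Num.max j j') _ _ i' j') es; try by rewrite ?ge_min ?le_max ?lexx ?orbT.
  move=> k l /(mesh_between (p := y.1 - s / 2) (q := y.1 + s / 2) d0) hk.
  move=> /(mesh_between (p := y.2 - s / 2) (q := y.2 + s / 2) d0) hl [x [h1 h2 h3 h4]].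
  have /andP[k1 k2] : y.1 - s / 2 < k%:~R * d < y.1 + s / 2.
    by apply: hk; clear - y1 y1' z1 z1' fy1 fy1' fz1 fz1' ds; lra.
  have /andP[l1 l2] : y.2 - s / 2 < l%:~R * d < y.2 + s / 2.
    by apply: hl; clear - y2 y2' z2 z2' fy2 fy2' fz2 fz2' ds; lra.
  apply: (sK (e x)); last by exists x.
  by apply/plane_ballP; clear - h1 h2 h3 h4 k1 k2 l1 l2 ds; split; lra.
Qed.

(** The part of a closed box outside the [r0]-neighbourhood of the compactum is compact, so the
    local mesh bounds have a common one. *)
Lemma uniform_mesh_escapes (r0 M : R) : connected (~` range e) -> 0 < r0 ->
  exists2 r : R, 0 < r & forall d, 0 < d < r -> forall i j : int,
    `|i%:~R * d| <= M -> `|j%:~R * d| <= M ->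
    (forall x, ~ ball (e x) r0 (i%:~R * d, j%:~R * d)) -> escapes (touches d) i j.
Proof.
move=> cK r0p.
pose Q : set (R * R) := (`[- M, M] `*` `[- M, M]) `&` ~` \bigcup_x ball (e x) r0.
have cQ : compact Q.
  apply: compact_closedI; first by apply: compact_setX; exact: segment_compact.
  by rewrite closedC; apply: bigcup_open => x _; exact: ball_open.
have QK y : Q y -> (~` range e) y.
  by move=> [_ nb] [x _ exy]; apply: nb; exists x => //; rewrite exy; exact: ballxx.
have /compact_near_coveringP/(_ R (0^'+) (fun d z =>
  escapes (touches d) (mesh_floor d z.1) (mesh_floor d z.2))) := cQ.
case.
  move=> y /QK /(complement_mesh_escapes cK)[r rp hr].
  exists (ball y r, [set d | 0 < d < r]) => /=.
    split; first exact: nbhsx_ballx.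
    by near=> d; apply/andP; split; near: d; [exact: nbhs_right_gt|exact: nbhs_right_lt].
  by move=> [z d] /= [yz dr]; exact: hr.
move=> r /= rp h; exists r => // d /andP[d0 dr] i j iM jM nb.
have := h d _ d0 (i%:~R * d, j%:~R * d); rewrite /= !mesh_floor_int//; apply.
  by rewrite /= sub0r normrN gtr0_norm.
split; first by split; rewrite /= in_itv /= -ler_norml.
by move=> [x _]; exact: nb.
Unshelve. all: by end_near. Qed.

(** * Triviality of Cech cocycles of a nonseparating planar compactum *)

Lemma int_bounded_seq (B : nat) :
  exists s : seq int, forall i : int, `|i| <= B%:Z -> i \in s.
Proof.
exists [seq k%:Z - B%:Z | k <- iota 0 (B + B).+1] => i iB.
by apply/mapP; exists (absz (i + B%:Z)); [rewrite mem_iota; lia|lia].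
Qed.

(** On the edges of touched squares the correction vanishes, so there the potential of the corrected
    cochain still integrates the cocycle. *)
Lemma planar_cocycle_trivial (x : cech_cocycle X) : connected (~` range e) ->
  cohomologous x (cocycle0 X).
Proof.
move=> cK; case: x => U c oU hc.
have [d d0 dU] := lebesgue_number oU.
have [M M0 Me] := embedding_bounded.
have d16 : 0 < d / 16 by rewrite divr_gt0.
have [r r0 hr] := uniform_mesh_escapes (M + d) cK d16.
(* Three scales: [A i j] contains the points within [d / 2] of its vertex, [near] vertices are
   within [d / 8] of the compactum, and a square escapes unless its lower left corner is within
   [d / 16]. In the latter case [t < d / 16] makes all four corners [near]. *)
pose t := Num.min r (d / 16) / 2.
have t0 : 0 < t by rewrite divr_gt0// lt_min r0.
have tm : t < Num.min r (d / 16) by rewrite /t ltr_pdivrMr// ltr_pMr ?lt_min ?r0// ltr1n.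
have [tr td] : t < r /\ t < d / 16 by move: tm; rewrite lt_min => /andP[].
have {}hr := hr t; rewrite t0 tr in hr; have {}hr := hr isT.
clearbody t; move=> {tm tr r r0}.
pose V (i j : int) : R * R := (i%:~R * t, j%:~R * t).
pose near i j := exists x, ball (e x) (d / 8) (V i j).
have /choice[A0 A0P] (ij : int * int) : exists A, near ij.1 ij.2 ->
    U A /\ forall x, ball (V ij.1 ij.2) (d / 2) (e x) -> A x.
  have [[x nx]|n] := pselect (near ij.1 ij.2); last by exists set0.
  have [A UA hA] := dU x; exists A => _; split => // x' hx'; apply: hA.
  move: nx hx' => /plane_ballP[/= ? ? ? ?] /plane_ballP[/= ? ? ? ?].
  by apply/plane_ballP; split; lra.
pose A i j := A0 (i, j).
have UA i j : near i j -> U (A i j) by move=> /(A0P (i, j))[].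
have inA i j x : near i j -> ball (V i j) (d / 2) (e x) -> A i j x.
  by move=> /(A0P (i, j))[_]; exact.
pose h i j : int := if `[< near i j /\ near (i + 1) j >]
  then c (A i j) (A (i + 1) j) else 0.
pose v i j : int := if `[< near i j /\ near i (j + 1) >]
  then c (A i j) (A i (j + 1)) else 0.
have tri i j i' j' i'' j'' x : near i j -> near i' j' -> near i'' j'' ->
    ball (V i j) (d / 2) (e x) -> ball (V i' j') (d / 2) (e x) ->
    ball (V i'' j'') (d / 2) (e x) ->
    c (A i j) (A i'' j'') = c (A i j) (A i' j') + c (A i' j') (A i'' j'').
  move=> n n' n'' b b' b''; apply: (cocycle_tri hc); [exact: UA..|].
  by exists x; split; [split|]; exact: inA.
have Vr i j : V (i + 1) j = (i%:~R * t + t, j%:~R * t).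
  by rewrite /V intrD1 mulrDl mul1r.
have Vu i j : V i (j + 1) = (i%:~R * t, j%:~R * t + t).
  by rewrite /V intrD1 mulrDl mul1r.
have Vru i j : V (i + 1) (j + 1) = (i%:~R * t + t, j%:~R * t + t).
  by rewrite /V !intrD1 !mulrDl !mul1r.
(* A point within [d / 8] of one corner lies in all four sets, so the cocycle identity equates each
   way round the square with the diagonal. *)
have curl0 i j : near i j -> near (i + 1) j -> near i (j + 1) ->
    near (i + 1) (j + 1) -> curl h v i j = 0.
  move=> n00 n10 n01 n11; rewrite /curl /h /v !asboolT//.
  have [x /plane_ballP[/= b1 b2 b3 b4]] := n00.
  have b00 : ball (V i j) (d / 2) (e x) by apply/plane_ballP; split => /=; lra.
  have b10 : ball (V (i + 1) j) (d / 2) (e x).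
    by rewrite Vr; apply/plane_ballP; split => /=; lra.
  have b01 : ball (V i (j + 1)) (d / 2) (e x).
    by rewrite Vu; apply/plane_ballP; split => /=; lra.
  have b11 : ball (V (i + 1) (j + 1)) (d / 2) (e x).
    by rewrite Vru; apply/plane_ballP; split => /=; lra.
  have e1 := tri _ _ _ _ _ _ _ n00 n10 n11 b00 b10 b11.
  have e2 := tri _ _ _ _ _ _ _ n00 n01 n11 b00 b01 b11.
  by rewrite -e1 e2; ring.
have supp i j : curl h v i j != 0 ->
    [/\ `|i%:~R * t| <= M + d, `|j%:~R * t| <= M + d & escapes (touches t) i j].
  move=> cn0.
  have [x xn] : exists x, [\/ ball (e x) (d / 8) (V i j),
      ball (e x) (d / 8) (V (i + 1) j), ball (e x) (d / 8) (V i (j + 1)) |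
      ball (e x) (d / 8) (V (i + 1) (j + 1))].
    apply: contrapT => /forallNP n; move/eqP: cn0; apply; rewrite /curl /h /v.
    rewrite !asboolF ?subrr//.
    - by move=> [[x nx] _]; apply: (n x); constructor 1.
    - by move=> [_ [x nx]]; apply: (n x); constructor 4.
    - by move=> [[x nx] _]; apply: (n x); constructor 2.
    - by move=> [[x nx] _]; apply: (n x); constructor 1.
  have [m1 m2 m3 m4] := Me x.
  have [iM jM] : `|i%:~R * t| <= M + d /\ `|j%:~R * t| <= M + d.
    rewrite !ler_norml; clear - m1 m2 m3 m4 xn t0 td Vr Vu Vru d0.
    by case: xn; rewrite ?Vru ?Vr ?Vu => /plane_ballP[/= ? ? ? ?];
      split; apply/andP; split; lra.
  split => //; apply: hr => // y /plane_ballP[/= b1 b2 b3 b4].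
  by move/eqP: cn0; apply; apply: curl0; exists y; rewrite ?Vru ?Vr ?Vu;
    apply/plane_ballP; clear - b1 b2 b3 b4 t0 td; split => /=; lra.
have [s sP] := int_bounded_seq (Num.truncn ((M + d) / t)).+1.
have inS i : `|i%:~R * t| <= M + d -> i \in s.
  rewrite ler_norml => /andP[i1 i2]; apply: sP; set B := (_.+1).
  have BM : M + d < B%:~R * t by rewrite -ltr_pdivrMr//; exact: truncnS_gt.
  have : i < B by apply: (mesh_lt t0); exact: le_lt_trans BM.
  have : - B%:Z < i by apply: (mesh_lt t0); rewrite intrN mulNr; lra.
  by lia.
have [|h' [v' [van exa]]] := @escapes_all_exact int (touches t)
    [seq (i, j) | i <- s, j <- s] h v.
  by move=> i j /supp[iM jM es]; split => //; apply: allpairs_f; exact: inS.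
have [b bP] := curl_free_exact exa.
pose star i j := [set x | ball (V i j) t (e x)].
(* Empty stars are dropped: a point of the star is what shows that the vertex chosen by [idx] is
   [near]. *)
pose W := [set S : set X | (exists ij, S = star ij.1 ij.2) /\ S !=set0].
have /choice[idx idxP] (S : set X) : exists ij, W S -> S = star ij.1 ij.2.
  have [[[ij ->] _]|n] := pselect (W S); first by exists ij.
  by exists (0, 0).
(* The stars containing a point are centred at corners of the grid square that contains it. *)
have star_floor x : exists i j, [/\ star i j x, touches t i j &
    forall k l, star k l x -> [/\ i <= k, k <= i + 1, j <= l & l <= j + 1]].
  exists (mesh_floor t (e x).1), (mesh_floor t (e x).2).
  have /andP[f1 f1'] := mesh_floorP (e x).1 t0.
  have /andP[f2 f2'] := mesh_floorP (e x).2 t0.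
  split; first by apply/plane_ballP; split => /=; lra.
    by exists x; split; lra.
  move=> k l /plane_ballP[/= b1 b2 b3 b4].
  split; rewrite -ltzD1; apply: (mesh_lt t0); rewrite !intrD1 !mulrDl !mul1r; lra.
have near_star i j x : star i j x -> near i j.
  move=> /plane_ballP[/= b1 b2 b3 b4]; exists x; apply/plane_ballP; split => /=; lra.
have starA i j x : star i j x -> A i j x.
  move=> sx; apply: inA; first exact: near_star sx.
  by apply: le_ball sx; lra.
exists W, (fun S => A (idx S).1 (idx S).2), (fun=> setT); split.
- split.
    move=> _ [[ij ->] _]; apply/he.2; exists (ball (V ij.1 ij.2) t) => //.
    exact: ball_open.
  apply/seteqP; split => // x _; have [i [j [sx _ _]]] := star_floor x.
  by exists (star i j) => //; split; [exists (i, j)|exists x].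
- move=> S WS; have e1 := idxP _ WS; split.
    by apply: UA; case: WS => _ [x Sx]; apply: (@near_star _ _ x); rewrite -e1.
  by move=> x Sx; apply: starA; rewrite -e1.
- by [].
exists (fun S => b (idx S).1 (idx S).2) => S S' WS WS' [x [Sx S'x]].
have e1 := idxP _ WS; have e2 := idxP _ WS'.
rewrite !fctE /pullback /= subr0.
have {Sx e1} : star (idx S).1 (idx S).2 x by rewrite -e1.
have {S'x e2} : star (idx S').1 (idx S').2 x by rewrite -e2.
move: (idx S) (idx S') => [k l] [k' l'] /= sx' sx.
have [i [j [sij touch kl]]] := star_floor x.
have [h0 h1 v0 v1] := van _ _ touch.
have corner p q : i <= p -> p <= i + 1 -> j <= q -> q <= j + 1 ->
    near p q /\ ball (V p q) (d / 2) (e x).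
  move=> /(mesh_le t0) p1 /(mesh_le t0) p2 /(mesh_le t0) q1 /(mesh_le t0) q2.
  move: p2 q2; rewrite !intrD1 !mulrDl !mul1r => p2 q2.
  have [y1 y2 y3 y4] := (plane_ballP _ _ _).1 sij.
  rewrite /= in y1 y2 y3 y4.
  split; last by apply/plane_ballP; split => /=; lra.
  by exists x; apply/plane_ballP; split => /=; lra.
have [n00 b00] : near i j /\ ball (V i j) (d / 2) (e x) by apply: corner; lia.
have [n10 b10] : near (i + 1) j /\ ball (V (i + 1) j) (d / 2) (e x).
  by apply: corner; lia.
have [n01 b01] : near i (j + 1) /\ ball (V i (j + 1)) (d / 2) (e x).
  by apply: corner; lia.
have [n11 b11] : near (i + 1) (j + 1) /\ ball (V (i + 1) (j + 1)) (d / 2) (e x).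
  by apply: corner; lia.
(* The potential [b] integrates [c] from the lower left corner to each corner of this square; the
   opposite corner is reached through [(i + 1, j)]. *)
have f p q : i <= p -> p <= i + 1 -> j <= q -> q <= j + 1 ->
    c (A i j) (A p q) = b p q - b i j.
  move=> p1 p2 q1 q2.
  have [?|?] : p = i \/ p = i + 1 by lia.
    have [?|?] : q = j \/ q = j + 1 by lia.
      subst p q; have := tri _ _ _ _ _ _ _ n00 n00 n00 b00 b00 b00.
      by move=> /eqP; rewrite -subr_eq0 opprD addNKr oppr_eq0 => /eqP->; rewrite subrr.
    subst p q; rewrite (bP i j).2 !fctE v0 addr0 /v asboolT//; ring.
  have [?|?] : q = j \/ q = j + 1 by lia.
    subst p q; rewrite (bP i j).1 !fctE h0 addr0 /h asboolT//; ring.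
  subst p q; rewrite (tri _ _ _ _ _ _ _ n00 n10 n11 b00 b10 b11).
  rewrite (bP (i + 1) j).2 (bP i j).1 !fctE h0 v1 !addr0 /h /v !asboolT//; ring.
have [k1 k2 l1 l2] := kl _ _ sx; have [k1' k2' l1' l2'] := kl _ _ sx'.
have [n b0] := corner _ _ k1 k2 l1 l2; have [n' b0'] := corner _ _ k1' k2' l1' l2'.
have := tri _ _ _ _ _ _ _ n00 n n' b00 b0 b0'.
by rewrite !f// => E; rewrite -[LHS](addKr (b k l - b i j)) -E; ring.
Qed.

End PlanarCompacta.

(** * Bounded components of the complement *)

Section SquareRootEstimates.
Variables (R : realType) (a b x y d : R).
Hypotheses (d0 : 0 < d) (hx : `|a ^+ 2 - b ^+ 2 - x| < d / 8)
  (hy : `|a * b *+ 2 - y| < d / 8).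

Let lx := ltr_normlP _ _ hx.
Let ly := ltr_normlP _ _ hy.

(** For [w = a + i b], the square of [a + b] is [|w| ^ 2 + Im (w ^ 2)]. If [d <= |x|], the first
    term is large since it bounds [|Re (w ^ 2)|]; otherwise [d <= y] and the second is. *)
Lemma approx_sqrt_sum_ge : d <= `|x| \/ d <= `|y| -> - (d / 8) <= y ->
  d / 2 <= (a + b) ^+ 2.
Proof.
move=> away ly0; have [h1 h2] := lx; have [h3 h4] := ly.
have q1 := sqr_ge0 a; have q2 := sqr_ge0 b.
have q3 := sqr_ge0 (a + b); have q4 := sqr_ge0 (a - b).
have e3 : (a + b) ^+ 2 = a ^+ 2 + b ^+ 2 + a * b *+ 2 by ring.
have e4 : (a - b) ^+ 2 = a ^+ 2 + b ^+ 2 - a * b *+ 2 by ring.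
rewrite e3 in q3 *; rewrite e4 in q4; clear lx ly hx hy e3 e4.
move: (a ^+ 2) (b ^+ 2) (a * b *+ 2) h1 h2 h3 h4 q1 q2 q3 q4.
by case: away; rewrite ler_normr => /orP[] ? *; lra.
Qed.

(** The product of [a + b] and [a - b] is within [d / 8] of [x], hence has its sign. This compares
    the branches of the root used above and below the base point. *)
Lemma approx_sqrt_sign : d <= `|x| ->
  (0 < b - a) (+) (0 < a + b) = (0 < x).
Proof.
move=> away; have [h1 h2] := lx.
have e3 : a ^+ 2 - b ^+ 2 = (a + b) * (a - b) by ring.
rewrite e3 in h1 h2.
have -> : (0 < b - a) = (a - b < 0) by rewrite -oppr_lt0 opprB.
move: (a + b) (a - b) h1 h2 => p q h1 h2; clear lx ly hx hy e3.
case: (ltrgt0P x) => x0.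
- move: away; rewrite gtr0_norm// => away; have pq : 0 < p * q by lra.
  by case: (ltrgt0P p) => c1; case: (ltrgt0P q) => c2 //; exfalso; nra.
- move: away; rewrite ltr0_norm// => away; have pq : p * q < 0 by lra.
  by case: (ltrgt0P p) => c1; case: (ltrgt0P q) => c2 //; exfalso; nra.
- by move: away; rewrite x0 normr0; lra.
Qed.
End SquareRootEstimates.

(** Replacing [a] by [- a] conjugates the square, which exchanges the upper and lower half
    planes. *)
Lemma approx_sqrt_diff_ge (R : realType) (a b x y d : R) :
  `|a ^+ 2 - b ^+ 2 - x| < d / 8 -> `|a * b *+ 2 - y| < d / 8 ->
  d <= `|x| \/ d <= `|y| -> y <= d / 8 -> d / 2 <= (b - a) ^+ 2.
Proof.
move=> hx hy away y0; rewrite addrC.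
apply: (@approx_sqrt_sum_ge _ (- a) b x (- y)) => //; rewrite ?sqrrN ?normrN//.
  by rewrite mulNr mulNrn -opprD normrN.
by rewrite lerN2.
Qed.

Lemma convex_itv (R : realType) (p q u v t : R) : 0 <= t <= 1 ->
  p <= u <= q -> p <= v <= q -> p <= u + t * (v - u) <= q.
Proof.
move=> /andP[t0 t1] /andP[pu uq] /andP[pv vq].
have h1 := mulr_ge0 t0 (_ : 0 <= v - p); have h2 := mulr_ge0 t0 (_ : 0 <= q - v).
by apply/andP; split; nra.
Qed.

Lemma convex_gt (R : realType) (p u v t : R) : 0 <= t <= 1 ->
  p < u -> p < v -> p < u + t * (v - u).
Proof.
move=> t01 pu pv; have [h1 h2] : p < Num.min u v /\ Num.min u v <= Num.max u v.
  by rewrite lt_min pu pv ge_min !le_max lexx.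
have /andP[h _] : Num.min u v <= u + t * (v - u) <= Num.max u v.
  by apply: convex_itv t01 _ _; rewrite ge_min le_max lexx ?orbT.
exact: lt_le_trans h1 h.
Qed.

(** * Square roots and the complement of a planar compactum *)

Section ComplementOfPlanarCompacta.
Variables (R : realType) (X : topologicalType) (e : X -> (R * R)%type).
Hypotheses (cX : compact [set: X]) (he : topological_embedding e).

Lemma disjoint_open_segment (D E : set (R * R)) (y z : R * R) :
  open D -> open E -> (forall w, D w -> E w -> False) ->
  (forall s : R, 0 <= s <= 1 ->
    let w := (y.1 + s * (z.1 - y.1), y.2 + s * (z.2 - y.2)) in D w \/ E w) ->
  D y -> D z.
Proof.
move=> oD oE DE seg Dy.
pose f (s : R) : R * R := (y.1 + s * (z.1 - y.1), y.2 + s * (z.2 - y.2)).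
have cf : continuous f.
  have cl (p q : R) : continuous (fun s : R => p + s * q).
    move=> s; apply: cvgD; first exact: cvg_cst.
    by apply: cvgM; [exact: cvg_id|exact: cvg_cst].
  move=> s; exact: (@cvg_pair _ _ _ (nbhs s) (nbhs _) (nbhs _) _ _ _ _ _
    (cl _ _ s) (cl _ _ s)).
have f1 : f 1 = z.
  by rewrite /f !mul1r !(addrC y.1) !(addrC y.2) !subrK -surjective_pairing.
have f0 : f 0 = y by rewrite /f !mul0r !addr0 -surjective_pairing.
have itvP s : `[0, 1]%classic s = (0 <= s <= 1) :> Prop by rewrite /= in_itv.
have := @segment_connected R 0 1 (`[0, 1] `&` f @^-1` D).
have -> : `[0, 1] `&` f @^-1` D = `[0, 1] `&` ~` (f @^-1` E).
  apply/seteqP; split => s [s01 h]; split => //.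
    by move=> h'; exact: DE h h'.
  by rewrite itvP in s01; case: (seg _ s01).
move=> H; have : `[0, 1]%classic (1 : R) by rewrite itvP ler01 lexx.
rewrite -H.
- by move=> [_ nE]; have [||] := seg 1; rewrite ?ler01 ?lexx// -/(f 1) f1.
- exists 0; split; first by rewrite itvP lexx ler01.
  by move=> E0; apply: DE Dy _; rewrite -f0.
- exists (f @^-1` D); first by apply: open_comp => // s _; exact: cf.
  apply/seteqP; split => s [s01 h]; split => //.
    by rewrite itvP in s01; case: (seg _ s01).
  by move=> h'; exact: DE h h'.
- exists (~` (f @^-1` E)) => //; rewrite closedC.
  by apply: open_comp => // s _; exact: cf.
Qed.

Definition has_approx_sqrt (p : R * R) : Prop := forall t : R, 0 < t ->
  exists a b : X -> R, [/\ continuous a, continuous b & forall x,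
    `|a x ^+ 2 - b x ^+ 2 - ((e x).1 - p.1)| < t /\
    `|a x * b x *+ 2 - ((e x).2 - p.2)| < t].

(** The mod 2 cochain built here is closed, hence has a potential. On a large loop outside [D] it
    agrees with [tv], whose ray is crossed exactly once, and no potential allows that. *)
Lemma approx_sqrt_no_bounded_component (D E : set (R * R)) (p : R * R) (M : R) :
  open D -> open E -> (forall w, D w -> E w -> False) ->
  (forall w, (~` range e) w -> D w \/ E w) ->
  (forall w, D w -> `|w.1| <= M /\ `|w.2| <= M) ->
  D p -> (~` range e) p -> has_approx_sqrt p -> False.
Proof.
move=> oD oE DE cov bD Dp Kp sqrtp.
have /nbhs_ballP[d0 /= d0p dK] : nbhs p (~` range e).
  by apply: open_nbhs_nbhs; split => //; rewrite openC; exact: (range_closed cX he).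
have away x : d0 <= `|(e x).1 - p.1| \/ d0 <= `|(e x).2 - p.2|.
  have [h1|h1] := lerP d0 `|(e x).1 - p.1|; first by left.
  have [h2|h2] := lerP d0 `|(e x).2 - p.2|; first by right.
  exfalso; apply: (dK (e x)); last by exists x.
  by split; rewrite /ball /= distrC.
have t0 : 0 < d0 / 8 by rewrite divr_gt0.
have [a [b [ca cb ab]]] := sqrtp _ t0.
(* Makes [(2 * ep) ^ 2] smaller than the lower bound [d0 / 2] for the square of [s] below, so that
   [s] cannot change sign between points where [a] and [b] differ by less than [ep]. *)
pose ep := Num.min 1 d0 / 4.
have ep0 : 0 < ep by rewrite divr_gt0// lt_min ltr01.
have epd : 4 * ep ^+ 2 <= d0 / 4.
  have m1 : Num.min 1 d0 <= 1 by rewrite ge_min lexx.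
  have m2 : Num.min 1 d0 <= d0 by rewrite ge_min lexx orbT.
  have m0 : 0 < Num.min 1 d0 by rewrite lt_min ltr01.
  by rewrite /ep; move: m0 m1 m2; set m := Num.min _ _ => *; nra.
clearbody ep.
have [r1 r10 ua] := embedding_uniform_continuity cX he ca ep0.
have [r2 r20 ub] := embedding_uniform_continuity cX he cb ep0.
pose m := Num.min (Num.min r1 r2) d0.
have mp : 0 < m by rewrite !lt_min r10 r20.
pose d := m / 8.
have dp : 0 < d by rewrite divr_gt0.
have [dr1 dr2 dd0] : [/\ d * 8 <= r1, d * 8 <= r2 & d * 8 <= d0].
  by rewrite /d divfK// /m; split; rewrite !ge_min lexx ?orbT.
clearbody d; move=> {m mp}.
(* Shifted by half a mesh, so that [p] is the centre of the square [(0, 0)] and no vertex is level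
   with [p]. *)
pose V (i j : int) : R * R := (p.1 - d / 2 + i%:~R * d, p.2 - d / 2 + j%:~R * d).
pose nearv i j x := [/\ (V i j).1 - d <= (e x).1, (e x).1 <= (V i j).1 + d,
  (V i j).2 - d <= (e x).2 & (e x).2 <= (V i j).2 + d].
(* Up to sign the approximate root w = a + i b of z = e x - p lies near the root r
   of z with positive imaginary part, and the sign can be read off [s]: for
   0 <= Im z, (a + b) ^ 2 is about |z| + Im z, for Im z <= 0, (b - a) ^ 2 is about
   |z| - Im z.  Here 1 <= j means that the vertex is above p. *)
pose s (j : int) x := if 1 <= j then a x + b x else b x - a x.
have sq_ge i j x : nearv i j x -> d0 / 2 <= s j x ^+ 2.
  move=> [_ _ n1 n2]; have [h1 h2] := ab x.
  rewrite /V /= in n1 n2; rewrite /s; case: ifP => j1.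
    apply: (approx_sqrt_sum_ge h1 h2 (away x)).
    by have := mesh_le dp j1; rewrite mul1r; clear - n1 n2 dd0 dp; lra.
  apply: (approx_sqrt_diff_ge h1 h2 (away x)).
  have /(mesh_le dp) : j <= 0 by clear - j1; lia.
  by rewrite mul0r; clear - n1 n2 dd0 dp; lra.
pose sg i j := `[< exists x, nearv i j x /\ 0 < s j x >].
have sgE i j x : nearv i j x -> sg i j = (0 < s j x).
  move=> nx; apply/idP/idP; last by move=> sx; apply/asboolP; exists x.
  move=> /asboolP[x' [nx' sx']]; rewrite ltNge; apply/negP => sx.
  have := sq_ge _ _ _ nx'; apply/negP; rewrite -ltNge.
  have xx' : ball (e x) (d * 3) (e x').
    apply/plane_ballP; clear - nx nx' dp.
    by case: nx nx' => ? ? ? ? [? ? ? ?]; split; lra.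
  have /ltr_normlW ha : `|a x' - a x| < ep.
    by rewrite distrC; apply: ua; apply: le_ball xx'; clear - dp dr1 dr2; lra.
  have /ltr_normlW hb : `|b x' - b x| < ep.
    by rewrite distrC; apply: ub; apply: le_ball xx'; clear - dp dr1 dr2; lra.
  have /ltr_normlW ha' : `|a x - a x'| < ep.
    by apply: ua; apply: le_ball xx'; clear - dp dr1 dr2; lra.
  have : s j x' < 2 * ep.
    by move: sx sx'; rewrite /s; case: ifP => _; clear - ha hb ha'; lra.
  by move: sx'; move: (s j x') => w w0 w2; clear - w0 w2 ep0 epd d0p; nra.
(* [tv] is supported on the edges crossing the horizontal ray going right from p:
   its only residue is 1 at p.  Near the compactum it is the coboundary of [sg]. *)
pose tv (i j : int) : bool := (j == 0) && (1 <= i).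
have sg_h i j x : nearv i j x -> nearv (i + 1) j x -> sg i j = sg (i + 1) j.
  by move=> n n'; rewrite (sgE _ _ _ n) (sgE _ _ _ n').
(* The formula for [s] changes only between [j = 0] and [j = 1]. There [e x] is nearly level with
   [p], so its horizontal distance is at least [d0] and [approx_sqrt_sign] tells whether it lies to
   the right, that is, whether [1 <= i]. *)
have sg_v i j x : nearv i j x -> nearv i (j + 1) x ->
    sg i j (+) sg i (j + 1) = tv i j.
  move=> n n'; rewrite (sgE _ _ _ n) (sgE _ _ _ n') /tv.
  have [j0|jn0] := eqVneq j 0; last first.
    by rewrite /s (_ : (1 <= j + 1) = (1 <= j)) ?addbb//; clear - jn0; lia.
  subst j; rewrite /s add0r lexx (_ : 1 <= 0 = false)//=.
  move: n n' => [n1 n2 n3 n4] [_ _ n3' n4'].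
  rewrite /V /= ?add0r ?mul0r ?mul1r in n1 n2 n3 n4 n3' n4'.
  have yd : `|(e x).2 - p.2| < d0.
    by rewrite ltr_norml; apply/andP; clear - n3 n4 n3' n4' dd0 dp; split; lra.
  have xd : d0 <= `|(e x).1 - p.1|.
    by case: (away x) => //; rewrite leNgt yd.
  rewrite (approx_sqrt_sign (ab x).1 xd).
  case: (leP 1 i) => i1.
    have := mesh_le dp i1; rewrite mul1r => i1'; rewrite ltNge; apply/negP => x0.
    by move: xd; rewrite ler0_norm//; clear - n1 n2 i1' dd0 dp x0 d0p; lra.
  have /(mesh_le dp) : i <= 0 by clear - i1; lia.
  rewrite mul0r => i1'; apply/negbTE/negP => x0.
  by move: xd; rewrite gtr0_norm//; clear - n1 n2 i1' dd0 dp x0 d0p; lra.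
pose Dv i j := `[< D (V i j) >].
(* Inside D replace [tv] by the coboundary of [sg]: this removes the residue at p
   and does not change the cochain far away. *)
pose gh i j : bool := if Dv i j || Dv (i + 1) j then sg i j (+) sg (i + 1) j else false.
pose gv i j : bool := if Dv i j || Dv i (j + 1) then sg i j (+) sg i (j + 1) else tv i j.
have Vr i j : V (i + 1) j = ((V i j).1 + d, (V i j).2).
  by rewrite /V intrD1 mulrDl mul1r addrA.
have Vu i j : V i (j + 1) = ((V i j).1, (V i j).2 + d).
  by rewrite /V intrD1 mulrDl mul1r addrA.
(* If the square meets the compactum, all four edges carry the coboundary of [sg]. Otherwise it lies
   entirely inside or entirely outside [D], and the square carrying the residue of [tv] is inside
   because it contains [p]. *)
have curl0 i j : curl gh gv i j = 0.
  pose sq (w : R * R) := [/\ (V i j).1 <= w.1, w.1 <= (V i j).1 + d,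
    (V i j).2 <= w.2 & w.2 <= (V i j).2 + d].
  have [[x [x1 x2 x3 x4]]|nt] := pselect (exists x, sq (e x)).
    have n00 : nearv i j x by clear - x1 x2 x3 x4 dp; split; lra.
    have n10 : nearv (i + 1) j x.
      by rewrite /nearv Vr; move: x1 x2 x3 x4; rewrite /V /=; clear - dp; split; lra.
    have n01 : nearv i (j + 1) x.
      by rewrite /nearv Vu; move: x1 x2 x3 x4; rewrite /V /=; clear - dp; split; lra.
    have n11 : nearv (i + 1) (j + 1) x.
      by rewrite /nearv Vu Vr; move: x1 x2 x3 x4; rewrite /V /=; clear - dp; split; lra.
    have ghE k l : nearv k l x -> nearv (k + 1) l x ->
        gh k l = sg k l (+) sg (k + 1) l.
      by move=> n n'; rewrite /gh; case: ifP => // _; rewrite -(sg_h _ _ _ n n') addbb.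
    have gvE k l : nearv k l x -> nearv k (l + 1) x ->
        gv k l = sg k l (+) sg k (l + 1).
      by move=> n n'; rewrite /gv; case: ifP => // _; rewrite -(sg_v _ _ _ n n').
    rewrite /curl ghE// gvE// ghE// gvE//.
    by case: (sg i j); case: (sg _ j); case: (sg i _); case: (sg _ _).
  have Dsq w w' : sq w -> sq w' -> D w -> D w'.
    move=> sw sw'; apply: (disjoint_open_segment oD oE DE) => t t01.
    apply: cov => -[x _ ex]; apply: nt; exists x; rewrite ex.
    case: sw sw' => [? ? ? ?] [? ? ? ?].
    have [h1 h2] : (V i j).1 <= w.1 + t * (w'.1 - w.1) <= (V i j).1 + d /\
        (V i j).2 <= w.2 + t * (w'.2 - w.2) <= (V i j).2 + d.
      by split; apply: convex_itv => //; apply/andP.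
    by case/andP: h1; case/andP: h2.
  have q00 : sq (V i j) by clear - dp; split; lra.
  have q10 : sq (V (i + 1) j) by rewrite /sq Vr /V /=; clear - dp; split; lra.
  have q01 : sq (V i (j + 1)) by rewrite /sq Vu /V /=; clear - dp; split; lra.
  have q11 : sq (V (i + 1) (j + 1)) by rewrite /sq Vu Vr /V /=; clear - dp; split; lra.
  have [D0|nD] := pselect (D (V i j)).
    have D1 w : sq w -> `[< D w >] by move=> sw; apply/asboolP; exact: Dsq D0.
    rewrite /curl /gh /gv /Dv !D1//=.
    by case: (sg i j); case: (sg _ j); case: (sg i _); case: (sg _ _).
  have D1 w : sq w -> `[< D w >] = false.
    by move=> sw; apply/asboolP => Dw; apply: nD; exact: Dsq Dw.
  rewrite /curl /gh /gv /Dv !D1//= /tv.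
  have -> : (1 <= i + 1) = (0 <= i) by clear; lia.
  have [j0|//] := eqVneq j 0; have [i0|i0] := eqVneq i 0.
    exfalso; apply: nD; apply: Dsq Dp => //; subst i j; rewrite /sq /V /= !mul0r !addr0.
    by clear - dp; split; lra.
  have -> : (0 <= i) = (1 <= i) by clear - i0; lia.
  by case: (1 <= i).
have [B bP] := curl_free_exact curl0.
(* From index [I] on, vertices lie outside the box bounding [D], so the cochain is [tv] there. *)
pose I : int := (Num.truncn ((M + `|p.1| + `|p.2| + d) / d)).+1.
have I1 : 1 <= I by rewrite /I; clear; lia.
have IM : M + `|p.1| + `|p.2| + d < I%:~R * d.
  by rewrite -ltr_pdivrMr//; exact: truncnS_gt.
have far i j : I <= `|i| \/ I <= `|j| -> Dv i j = false.
  move=> h; apply/asboolP => /bD; rewrite /V /= !ler_norml.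
  move=> [/andP[h1 h2] /andP[h3 h4]].
  have p1 := ler_norm p.1; have p2 := ler_norm p.2.
  have p1' := ler_norm (- p.1); have p2' := ler_norm (- p.2).
  rewrite !normrN in p1' p2'.
  have n1 := normr_ge0 p.1; have n2 := normr_ge0 p.2.
  case: h; rewrite ler_normr => /orP[] /(mesh_le dp);
    rewrite ?intrN ?mulNr; clear - IM p1 p2 p1' p2' n1 n2 h1 h2 h3 h4 dp; lra.
have row j : I <= `|j| -> forall i i', B i j = B i' j.
  move=> jI; apply: int_step_eq => i; rewrite (bP i j).1 /gh !far ?addr0//; by right.
have colN j j' : B (- I) j = B (- I) j'.
  move: j j'; apply: int_step_eq => j.
  rewrite (bP _ j).2 /gv !far ?normrN ?ler_norm//; try by left.
  by rewrite /tv (_ : 1 <= - I = false) ?andbF ?addr0//; clear - I1; lia.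
(* The right side of the loop crosses the ray once, between [j = 0] and [j = 1]; the other three
   sides do not. *)
have col j j' : B I j (+) (1 <= j) = B I j' (+) (1 <= j').
  apply: (int_step_eq (f := fun j => B I j (+) (1 <= j))) => k.
  rewrite (bP _ k).2 /gv !far ?ler_norm//; try by left.
  rewrite /tv I1 andbT (_ : (1 <= k + 1) = (0 <= k)); last by clear; lia.
  have [->|k0] := eqVneq k 0; first by case: (B I 0).
  by rewrite addr0 (_ : (0 <= k) = (1 <= k))//; clear - k0; lia.
have := col I (- I).
rewrite I1 (_ : 1 <= - I = false); last by clear - I1; lia.
rewrite (row I (ler_norm I) I (- I)) (row (- I) _ I (- I)) ?normrN ?ler_norm//.
by rewrite (colN I (- I)); case: (B _ _).
Qed.

(** Of the two pieces of a separation, the one missing the far point [q] is bounded: everything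
    outside the box around the compactum is joined to [q] by segments. *)
Lemma approx_sqrt_complement_connected :
  (forall p, (~` range e) p -> has_approx_sqrt p) -> connected (~` range e).
Proof.
move=> sqrtp Z Z_neq0 [P oP ZP] [F cF ZF]; apply: contrapT => nZ.
have oK : open (~` range e) by rewrite openC; exact: (range_closed cX he).
have oZ : open Z by rewrite ZP; exact: openI.
pose Z1 := ~` range e `&` ~` Z.
have oZ' : open Z1.
  have -> : Z1 = ~` range e `&` ~` F.
    apply/seteqP; split => y [Ky h]; split => // h'; apply: h; first by rewrite ZF.
    by move: h'; rewrite ZF => -[].
  by apply: openI => //; rewrite openC.
have [c Zc] := Z_neq0.
have [c' Z1c] : Z1 !=set0.
  apply/set0P/eqP => e0; apply: nZ; apply/seteqP; split => [y|y Ky].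
    by rewrite ZP => -[].
  by apply: contrapT => nZy; have : set0 y by rewrite -e0.
have [M M0 Me] := embedding_bounded cX he.
pose q : R * R := (M + 1, M + 1).
have Kq : (~` range e) q.
  by move=> [x _ ex]; have [_ m _ _] := Me x; move: m; rewrite ex /q /=; lra.
have main (D E : set (R * R)) (p : R * R) : open D -> open E ->
    (forall w, D w -> E w -> False) -> (forall w, (~` range e) w -> D w \/ E w) ->
    E q -> D p -> (~` range e) p -> False.
  move=> oD oE DE cov Eq Dp Kp.
  apply: (@approx_sqrt_no_bounded_component D E p M) => //; last exact: sqrtp.
  have ED w : E w -> D w -> False by move=> ? ?; exact: (DE w).
  have cov' w : (~` range e) w -> E w \/ D w by move=> /cov[]; [right|left].
  (* Each of the four half planes outside the box is convex and misses the compactum. *)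
  have step (y z : R * R) : (M < y.1 /\ M < z.1) \/ (M < - y.1 /\ M < - z.1) \/
      (M < y.2 /\ M < z.2) \/ (M < - y.2 /\ M < - z.2) -> E y -> E z.
    move=> h; apply: (disjoint_open_segment oE oD ED) => t t01 /=.
    apply: cov' => -[x _ ex]; have := Me x; rewrite ex /= => -[m1 m2 m3 m4].
    by case: h => [[h1 h2]|[[h1 h2]|[[h1 h2]|[h1 h2]]]];
      have := convex_gt t01 h1 h2; clear - m1 m2 m3 m4; lra.
  have out w : M < `|w.1| \/ M < `|w.2| -> E w.
    rewrite !ltr_normr; case: w => w1 w2 /= [/orP[]|/orP[]] h.
    - by apply: (step q) Eq; left; rewrite /=; clear - h; lra.
    - apply: (step (- (M + 1), M + 1)); first by right; left; rewrite /=; clear - h; lra.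
      by apply: (step q) Eq; right; right; left; rewrite /=; clear - M0 e; lra.
    - by apply: (step q) Eq; right; right; left; rewrite /=; clear - h; lra.
    - apply: (step (M + 1, - (M + 1))).
        by right; right; right; rewrite /=; clear - h; lra.
      by apply: (step q) Eq; left; rewrite /=; clear - M0 e; lra.
  by move=> w Dw; split; rewrite leNgt; apply/negP => h; apply: (DE w) => //; apply: out;
    [left|right].
have [Zq|nZq] := pselect (Z q).
  apply: (main Z1 Z c') => //; last by case: Z1c.
    by move=> w [_ h] /h.
  by move=> w Kw; have [|] := pselect (Z w); [right|left].
apply: (main Z Z1 c) => //; last by move: Zc; rewrite ZP => -[].
  by move=> w h [_ /(_ h)].
by move=> w Kw; have [|] := pselect (Z w); [left|right].
Qed.

End ComplementOfPlanarCompacta.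

(** * Approximate square roots in C(X) *)

Section ComplexContinuity.
Variables (R : realType) (T : topologicalType).
Local Open Scope complex_scope.

Lemma continuous_complex (a b : T -> R) : continuous a -> continuous b ->
  continuous (fun x => (a x +i* b x : R[i]^o)).
Proof.
move=> ca cb x; apply/(@cvgrPdist_lt R[i] R[i]^o) => t t0.
have [tr t0'] : t = (complex.Re t)%:C /\ 0 < complex.Re t.
  by move: t0; case: (t) => p q; rewrite ltcE /= => /andP[/eqP-> p0].
near=> y.
have -> : (a x +i* b x : R[i]^o) - (a y +i* b y) = (a x - a y) +i* (b x - b y) by [].
have : `|a x - a y| < complex.Re t / 2.
  near: y; have /cvgrPdist_lt := ca x; apply; exact: divr_gt0.
have : `|b x - b y| < complex.Re t / 2.
  near: y; have /cvgrPdist_lt := cb x; apply; exact: divr_gt0.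
set p := a x - a y; set q := b x - b y => qt pt.
rewrite tr /= /Num.norm /= ltcR.
have e : Num.sqrt (p ^+ 2 + q ^+ 2) <= `|p| + `|q|.
  rewrite -[leRHS]ger0_norm ?addr_ge0// -sqrtr_sqr ler_wsqrtr//; clearbody p q.
  have pq := mulr_ge0 (normr_ge0 p) (normr_ge0 q).
  by rewrite [leRHS]sqrrD !real_normK ?num_real//; lra.
by apply: le_lt_trans e _; rewrite [ltRHS]splitr ltrD.
Unshelve. all: by end_near. Qed.

Lemma continuous_Re (f : T -> R[i]^o) :
  continuous f -> continuous (fun x => complex.Re (f x)).
Proof.
move=> cf x; apply/cvgrPdist_lt => t t0; near=> y.
have h : `|f x - f y| < t%:C.
  by near: y; have /(@cvgrPdist_lt R[i] R[i]^o) := cf x; apply; rewrite ltcR.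
have h' := normc_ge_Re (f x - f y : R[i]).
rewrite -ltcR; apply: le_lt_trans h; apply: le_trans h'.
by case: (f x) (f y) => ? ? [].
Unshelve. all: by end_near. Qed.

Lemma continuous_Im (f : T -> R[i]^o) :
  continuous f -> continuous (fun x => complex.Im (f x)).
Proof.
move=> cf x; apply/cvgrPdist_lt => t t0; near=> y.
have h : `|f x - f y| < t%:C.
  by near: y; have /(@cvgrPdist_lt R[i] R[i]^o) := cf x; apply; rewrite ltcR.
have h' : `|complex.Im (f x - f y : R[i])|%:C <= `|f x - f y : R[i]|.
  case: (f x - f y : R[i]) => p q.
  by rewrite normc_def lecR -sqrtr_sqr ler_wsqrtr//= lerDr sqr_ge0.
rewrite -ltcR; apply: le_lt_trans h; apply: le_trans h'.
by case: (f x) (f y) => ? ? [].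
Unshelve. all: by end_near. Qed.
End ComplexContinuity.

Lemma CX_norm_ge (R : realType) (X : topologicalType) (cX : compact [set: X])
    (f : CX_structure R X) x : Normc.normc (f x) <= cs_norm f.
Proof.
have cn : continuous (fun x => Normc.normc (f x : R[i])).
  move=> y; have -> : (fun x => Normc.normc (f x : R[i])) =
      (fun z : R[i]^o => complex.Re `|z|) \o f by [].
  apply: continuous_comp; first exact: cts_fun.
  by apply: continuous_Re => z; exact: norm_continuous.
have [M Mb] := continuous_bounded cX cn.
rewrite /=; apply: ub_le_sup; last by exists x.
by exists M => _ [y _ <-]; apply: le_trans (Mb y); exact: ler_norm.
Qed.

Lemma CX_norm_le (R : realType) (X : topologicalType) (f : CX_structure R X)
    (M : R) : 0 <= M -> (forall x, Normc.normc (f x : R[i]) <= M) ->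
  cs_norm f <= M.
Proof.
move=> M0 h; rewrite /=.
(* For empty [X] the norm is the supremum of the empty set, which is 0 by convention. *)
have [->|ne] := eqVneq (range (fun x : X => Normc.normc (f x : R[i]))) set0.
  by rewrite sup0.
apply: sup_le_ub; first exact/set0P.
by move=> _ [x _ <-]; exact: h.
Qed.

Lemma compact_set_type (T : topologicalType) (A : set T) :
  compact A -> compact [set: set_type A].
Proof.
move=> cA F PF _.
have FA : (set_val @ F) A.
  by apply: (@filterS _ F _ setT) => [y _|]; [exact: set_valP|exact: filterT].
have [p [Ap clp]] := cA (set_val @ F) _ FA.
exists (SigSub (mem_set Ap)); split => // B C FB [_ [[V oV <-] /= Vp VC]].
have FB' : (set_val @ F) (set_val @` B).
  by apply: (@filterS _ F _ B) FB => b Bb; exists b.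
have [_ [[b Bb <-] Vb]] := clp _ V FB' (open_nbhs_nbhs (conj oV Vp)).
by exists b; split => //; exact: VC.
Qed.

Lemma hausdorff_set_type (T : topologicalType) (A : set T) :
  hausdorff_space T -> hausdorff_space (set_type A).
Proof.
move=> hT x y xy; apply: val_inj; apply: hT => U V Ux Vy.
have [||z [Uz Vz]] := xy (set_val @^-1` U) (set_val @^-1` V).
- exact: (@initial_continuous _ _ (set_val : A -> T)).
- exact: (@initial_continuous _ _ (set_val : A -> T)).
by exists (set_val z).
Qed.

(** * The double cover of a continuum by square roots *)

Section SquareRootCover.
Local Open Scope complex_scope.
Variables (R : realType) (X : topologicalType) (u1 u2 : X -> R).
Hypotheses (conX : continuum X) (cu1 : continuous u1) (cu2 : continuous u2).

(** The complex equation [w ^ 2 = u x], split into real and imaginary parts. *)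
Definition sqrt_cover : set (X * (R * R)) :=
  [set y | y.2.1 ^+ 2 - y.2.2 ^+ 2 = u1 y.1 /\ y.2.1 * y.2.2 *+ 2 = u2 y.1].

Local Notation Y := (set_type sqrt_cover).

Lemma sqr_complex (a b : R) : (a +i* b) ^+ 2 = (a ^+ 2 - b ^+ 2) +i* (a * b *+ 2).
Proof. by rewrite !expr2; simpc; congr (_ +i* _); ring. Qed.

Lemma sqrt_cover_ex x : exists w, sqrt_cover (x, w).
Proof.
have := sqr_sqrtc (u1 x +i* u2 x); case: (sqrtc _) => a b.
by rewrite sqr_complex => -[? ?]; exists (a, b).
Qed.

Lemma sqrt_cover_fiber (x : X) (a b a' b' : R) : sqrt_cover (x, (a, b)) ->
  sqrt_cover (x, (a', b')) -> (a', b') = (a, b) \/ (a', b') = (- a, - b).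
Proof.
move=> [/= h1 h2] [/= h3 h4].
have /eqP : (a' +i* b') ^+ 2 = (a +i* b) ^+ 2.
  by rewrite !sqr_complex h1 h2 h3 h4.
by rewrite eqf_sqr => /orP[] /eqP[-> ->]; [left|right].
Qed.

Lemma sqrt_cover_closed : closed sqrt_cover.
Proof.
have c1 : continuous (fun y : X * (R * R) => y.2.1).
  move=> y; apply: (@continuous_comp _ _ _ snd fst); [exact: cvg_snd|exact: cvg_fst].
have c2 : continuous (fun y : X * (R * R) => y.2.2).
  move=> y; apply: (@continuous_comp _ _ _ snd snd); exact: cvg_snd.
have -> : sqrt_cover =
    (fun y => y.2.1 ^+ 2 - y.2.2 ^+ 2 - u1 y.1) @^-1` [set 0] `&`
    (fun y => y.2.1 * y.2.2 *+ 2 - u2 y.1) @^-1` [set 0].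
  apply/seteqP; split => [y [/= -> ->]|y [/= /subr0_eq h1 /subr0_eq h2]] //.
  by split; rewrite /= subrr.
apply: closedI; apply: closed_comp; (try exact: closed_eq) => y _.
  apply: cvgB; last by apply: continuous_comp; [exact: cvg_fst|exact: cu1].
  by apply: cvgB; apply: cvgM; (exact: c1 || exact: c2).
apply: cvgB; last by apply: continuous_comp; [exact: cvg_fst|exact: cu2].
by apply: cvgMn; apply: cvgM; (exact: c1 || exact: c2).
Qed.

(** The equation gives [|w| ^ 4 = u1 ^ 2 + u2 ^ 2], so the fibres are uniformly bounded. *)
Lemma sqrt_cover_compact : compact sqrt_cover.
Proof.
have [_ cX _] := conX.
have [M1 h1] := continuous_bounded cX cu1.
have [M2 h2] := continuous_bounded cX cu2.
pose C : R := M1 + M2 + 1.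
have cB : compact ([set: X] `*` (`[- C, C] `*` `[- C, C])).
  by apply: compact_setX => //; apply: compact_setX; exact: segment_compact.
apply: subclosed_compact sqrt_cover_closed cB _.
move=> [x [a b]] [/= ha hb].
have := h1 x; have := h2 x; have := normr_ge0 (u1 x); have := normr_ge0 (u2 x).
have : (a ^+ 2 + b ^+ 2) ^+ 2 <= (`|u1 x| + `|u2 x|) ^+ 2.
  rewrite [leRHS]sqrrD !real_normK ?num_real//.
  have -> : (a ^+ 2 + b ^+ 2) ^+ 2 = u1 x ^+ 2 + u2 x ^+ 2 by rewrite -ha -hb; ring.
  by have := mulr_ge0 (normr_ge0 (u1 x)) (normr_ge0 (u2 x)); lra.
rewrite ler_sqr ?nnegrE ?addr_ge0 ?sqr_ge0// => h p2 p1 q2 q1.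
have {}h : a ^+ 2 + b ^+ 2 <= C - 1 by rewrite /C; lra.
have C1 : 1 <= C by rewrite /C; lra.
split => //=; split; rewrite /= in_itv /= -ler_norml -ler_sqr ?nnegrE ?normr_ge0//;
  rewrite ?real_normK ?num_real//; nra.
Qed.

Let pr (y : Y) : X := (set_val y).1.
Let val_cts : continuous (set_val : Y -> _).
Proof. exact: initial_continuous. Qed.

Lemma sqrt_cover_proj_continuous : continuous pr.
Proof. by move=> y; apply: continuous_comp; [exact: val_cts|exact: cvg_fst]. Qed.

Lemma sqrt_cover_proj_surj x : exists y, pr y = x.
Proof.
by have [w h] := sqrt_cover_ex x; exists (SigSub (mem_set h)).
Qed.

Let cY : compact [set: Y].
Proof. exact: compact_set_type sqrt_cover_compact. Qed.

Lemma sqrt_cover_proj_closed (Z : set Y) : closed Z -> closed (pr @` Z).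
Proof.
have [_ _ hX] := conX.
move=> cZ; apply: compact_closed => //; apply: continuous_compact.
  by apply: continuous_subspaceT; exact: sqrt_cover_proj_continuous.
exact: subclosed_compact cZ cY _.
Qed.

(** The involution sends [w] to [- w]. *)
Lemma sqrt_cover_involution : exists s : Y -> Y, [/\ continuous s,
  involutive s & forall y y', pr y = pr y' <-> y' = y \/ y' = s y].
Proof.
have sP (y : Y) : sqrt_cover ((set_val y).1, (- (set_val y).2.1, - (set_val y).2.2)).
  by have [/= h1 h2] := set_valP y; split; rewrite /= -?h1 -?h2; ring.
exists (fun y => SigSub (mem_set (sP y))); split.
- apply: (@continuous_comp_initial _ _ _ (set_val : Y -> X * (R * R))) => y.
  have h : set_val z @[z --> y] --> set_val y := @val_cts y.
  have h2 : (set_val z).2 @[z --> y] --> (set_val y).2.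
    exact: (cvg_comp _ _ h (@cvg_snd _ _ _ _ _)).
  have h1 : (set_val z).1 @[z --> y] --> (set_val y).1.
    exact: (cvg_comp _ _ h (@cvg_fst _ _ _ _ _)).
  have h21 : (set_val z).2.1 @[z --> y] --> (set_val y).2.1.
    exact: (cvg_comp _ _ h2 (@cvg_fst _ _ _ _ _)).
  have h22 : (set_val z).2.2 @[z --> y] --> (set_val y).2.2.
    exact: (cvg_comp _ _ h2 (@cvg_snd _ _ _ _ _)).
  have h3 : (- (set_val z).2.1, - (set_val z).2.2) @[z --> y] -->
      (- (set_val y).2.1, - (set_val y).2.2).
    exact: (@cvg_pair _ _ _ (nbhs y) (nbhs _) (nbhs _) _ _ _ _ _ (cvgN h21) (cvgN h22)).
  exact: (@cvg_pair _ _ _ (nbhs y) (nbhs _) (nbhs _) _ _ _ _ _ h1 h3).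
- case=> -[x [a b]] h; apply: val_inj; by rewrite /= !opprK.
- move=> y y'; split; last by case=> ->.
  case: y y' => [[x [a b]] Y1] [[x' [a' b']] Y2]; rewrite /pr /= => xx'.
  subst x'; have := sqrt_cover_fiber (set_mem Y1) (set_mem Y2).
  by case=> -[? ?]; subst; [left|right]; congr exist; exact: Prop_irrelevance.
Qed.

(** A proper nonempty clopen set [B] meets each fibre in exactly one point, so it is the graph of a
    continuous square root. *)
Lemma sqrt_cover_connected :
  (~ exists a b : X -> R, [/\ continuous a, continuous b &
    forall x, sqrt_cover (x, (a x, b x))]) -> connected [set: Y].
Proof.
have [cnX _ _] := conX.
have [s [cs ss sP]] := sqrt_cover_involution.
(* An invariant clopen set and its complement have disjoint images, closed because [pr] is a closed
   map; connectedness of [X] leaves no room for both. *)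
have inv (Z : set Y) : open Z -> closed Z -> s @^-1` Z = Z ->
    Z !=set0 -> Z = setT.
  move=> oZ cZ sZ [z Zz].
  have dis : pr @` Z = ~` (pr @` (~` Z)).
    apply/seteqP; split => [_ [y Zy <-] [y' nZy' /sP[?|?]]|x nx].
    + by apply: nZy'; subst y.
    + by subst y; apply: nZy'; rewrite -sZ.
    + have [y yx] := sqrt_cover_proj_surj x; exists y => //.
      by apply: contrapT => nZy; apply: nx; exists y.
  have /= e : pr @` Z = setT.
    apply: cnX; first by exists (pr z), z.
      exists (pr @` Z); last by rewrite setTI.
      by rewrite dis openC; apply: sqrt_cover_proj_closed; rewrite closedC.
    by exists (pr @` Z); rewrite ?setTI//; exact: sqrt_cover_proj_closed.
  rewrite dis in e.
  apply/seteqP; split => // y _; apply: contrapT => nZ.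
  have : setT (pr y) by []. by rewrite -e; apply; exists y.
move=> nroot B B0 [C oC]; rewrite setTI => ?; subst C => -[C cC].
rewrite setTI => ?; subst C; apply: contrapT => nB; apply: nroot.
have osB : open (s @^-1` B) by apply: open_comp => // y _; exact: cs.
have csB : closed (s @^-1` B) by apply: closed_comp => // y _; exact: cs.
have sI : B `&` s @^-1` B = set0.
  apply: contrapT => /eqP/set0P ne; apply: nB.
  have := inv (B `&` s @^-1` B) (openI _ _) (closedI _ _) _ ne.
  move=> /(_ oC osB cC csB); rewrite preimage_setI -comp_preimage.
  rewrite (_ : s \o s = id); last by apply/funext.
  rewrite preimage_id setIC => /(_ erefl) h.
  by apply/seteqP; split => // y _; have : setT y by []; rewrite -h => -[].
have sU : B `|` s @^-1` B = setT.
  apply: inv; [exact: openU|exact: closedU| |by case: B0 => b Bb; exists b; left].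
  rewrite preimage_setU -comp_preimage (_ : s \o s = id); last by apply/funext.
  by rewrite preimage_id setUC.
have /choice[g gP] x : exists y, B y /\ pr y = x.
  have [y <-] := sqrt_cover_proj_surj x.
  have : setT y by []. rewrite -sU => -[By|By]; first by exists y.
  by exists (s y); split => //; apply/esym/sP; right.
(* The preimage of a closed set under the section is the image of a closed part of [B]. *)
have cg (f : Y -> R) : continuous f -> continuous (f \o g).
  move=> cf; apply/continuous_closedP => F cF.
  have -> : (f \o g) @^-1` F = pr @` (B `&` f @^-1` F).
    apply/seteqP; split => [x Fx|x [y [By Fy] yx]].
      by exists (g x) => //; [split => //|]; have [] := gP x.
    have [Bg gx] := gP x.
    have /sP[gy|gy] : pr y = pr (g x) by rewrite gx.
      by rewrite /preimage /= gy.
    have : set0 y by rewrite -sI; split => //=; rewrite /preimage/= -gy.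
    by [].
  apply: sqrt_cover_proj_closed; apply: closedI => //.
  by apply: closed_comp => // y _; exact: cf.
exists (fun x => (set_val (g x)).2.1), (fun x => (set_val (g x)).2.2); split.
- apply: (cg (fun y => (set_val y).2.1)) => y.
  apply: (@continuous_comp _ _ _ set_val (fun y => y.2.1)); first exact: val_cts.
  by apply: (@continuous_comp _ _ _ snd fst); [exact: cvg_snd|exact: cvg_fst].
- apply: (cg (fun y => (set_val y).2.2)) => y.
  apply: (@continuous_comp _ _ _ set_val (fun y => y.2.2)); first exact: val_cts.
  by apply: (@continuous_comp _ _ _ snd snd); exact: cvg_snd.
move=> x; have [_] := gP x; have := set_valP (g x); rewrite /pr.
by case: (g x) => -[x' [a b]] m /= h gx; rewrite -gx.
Qed.

Lemma sqrt_cover_continuum : connected [set: Y] -> continuum Y.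
Proof.
have [_ _ hX] := conX; split; first by [].
  exact: cY.
by apply: hausdorff_set_type; do 2 apply: hausdorff_prod => //; exact: Rhausdorff.
Qed.

End SquareRootCover.

(** * Approximate square roots from existential closedness *)

Lemma CX_pullback_embedding (R : realType) (X Y : topologicalType) (p : Y -> X)
    (cp : continuous p) : (forall x, exists y, p y = x) ->
  exists2 j : CX_structure R X -> CX_structure R Y, cstar_embedding j &
    forall f y, j f y = f (p y).
Proof.
move=> sp.
have cf (f : CX_structure R X) : continuous (f \o p : Y -> R[i]^o).
  by move=> y; apply: continuous_comp; [exact: cp|exact: cts_fun].
exists (fun f => (mkcts (cf f) : continuousType Y R[i]^o)) => //.
split.
  move=> f g fg; apply/continuousEP => x; have [y <-] := sp x.
  exact: (congr1 (fun h : continuousType Y R[i]^o => h y) fg).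
split.
- by apply/continuousEP.
- by apply/continuousEP.
- by move=> f g; apply/continuousEP.
- by move=> f g; apply/continuousEP.
split.
- by move=> f; apply/continuousEP.
- by move=> a f; apply/continuousEP.
(* Surjectivity of [p] makes the two sets of moduli equal, so the norms agree. *)
move=> f /=; congr sup; apply/seteqP; split => _ [y _ <-]; first by exists (p y).
by have [z <-] := sp y; exists z.
Qed.

(** Without an exact root of [u], the double cover is a continuum whose function algebra contains
    one. The infimum of the norm of [w ^ 2 - u] is then at most 0 there, hence also in C(X). *)
Lemma coec_approx_sqrt (R : realType) (X : topologicalType) (u1 u2 : X -> R) :
  co_existentially_closed R X -> continuous u1 -> continuous u2 ->
  forall t : R, 0 < t -> exists a b : X -> R,
  [/\ continuous a, continuous b & forall x,
    `|a x ^+ 2 - b x ^+ 2 - u1 x| < t /\ `|a x * b x *+ 2 - u2 x| < t].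
Proof.
move=> [conX [_ ec]] cu1 cu2 t t0.
have [[a [b [ca cb ab]]]|nroot] := pselect (exists a b : X -> R,
    [/\ continuous a, continuous b & forall x, sqrt_cover u1 u2 (x, (a x, b x))]).
  by exists a, b; split => // x; have [/= -> ->] := ab x; rewrite !subrr normr0.
pose Y := set_type (sqrt_cover u1 u2).
have conY : continuum Y.
  exact: sqrt_cover_continuum (sqrt_cover_connected conX cu1 cu2 nroot).
have [j je jE] := CX_pullback_embedding R (@sqrt_cover_proj_continuous R X u1 u2)
  (@sqrt_cover_proj_surj R X u1 u2).
pose u : CX_structure R X :=
  (mkcts (continuous_complex cu1 cu2) : continuousType X R[i]^o).
have TY : Tconn_model (CX_structure R Y).
  exists Y => //; exists id; last by exists id.
  by split=> //; split.
have val_cts : continuous (set_val : Y -> X * (R * R)) by exact: initial_continuous.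
have c1 : continuous (fun y : Y => (set_val y).2.1).
  move=> y; apply: (@continuous_comp _ _ _ set_val (fun y => y.2.1)).
    exact: val_cts.
  by apply: (@continuous_comp _ _ _ snd fst); [exact: cvg_snd|exact: cvg_fst].
have c2 : continuous (fun y : Y => (set_val y).2.2).
  move=> y; apply: (@continuous_comp _ _ _ set_val (fun y => y.2.2)).
    exact: val_cts.
  by apply: (@continuous_comp _ _ _ snd snd); exact: cvg_snd.
pose w : CX_structure R Y :=
  (mkcts (continuous_complex c1 c2) : continuousType Y R[i]^o).
pose phi : qf_formula R ('I_1 + 'I_1) :=
  FNorm (TAdd (TMul (TVar R (inl ord0)) (TVar R (inl ord0)))
    (TScale (-1) (TVar R (inr ord0)))).
(* Quantifiers range over balls of natural radius, so a radius above the norm of [w] is taken. *)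
pose k := fun _ : 'I_1 => (Num.truncn (cs_norm w)).+1.
have := ec _ j TY je 1%N 1%N k phi (fun=> u).
have le0 : (inf_val k phi (j \o (fun=> u)) <= 0)%E.
  apply: (@le_trans _ _ (formula_val (join_val (fun=> w) (j \o (fun=> u))) phi)%:E).
    apply: ereal_inf_lbound; exists (fun=> w) => // i.
    by apply: ltW; exact: truncnS_gt.
  rewrite lee_fin; apply: CX_norm_le => // y.
  have -> : term_val (join_val (fun=> w) (j \o (fun=> u)))
    (TAdd (TMul (TVar R (inl ord0)) (TVar R (inl ord0)))
      (TScale (-1) (TVar R (inr ord0)))) y = w y * w y + (-1) * j u y :> R[i] by [].
  have [/= h1 h2] := set_valP y.
  have -> : w y = ((set_val y).2.1 +i* (set_val y).2.2)%C :> R[i] by [].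
  rewrite jE mulN1r -expr2.
  by rewrite sqr_complex h1 h2 subrr Normc.normc0.
move=> E; rewrite -E in le0.
have /ereal_inf_lt[_ [z zk <-] /=] : (inf_val k phi (fun=> u) < t%:E)%E.
  by apply: le_lt_trans le0 _; rewrite lte_fin.
rewrite lte_fin => zt.
exists (fun x => complex.Re (z ord0 x)), (fun x => complex.Im (z ord0 x)); split.
- by apply: continuous_Re; exact: cts_fun.
- by apply: continuous_Im; exact: cts_fun.
move=> x; have [_ cX _] := conX; have := le_lt_trans (CX_norm_ge cX _ x) zt.
have -> : term_val (join_val z (fun _ : 'I_1 => u))
  (TAdd (TMul (TVar R (inl ord0)) (TVar R (inl ord0)))
    (TScale (-1) (TVar R (inr ord0)))) x
  = z ord0 x * z ord0 x + (-1) * (u1 x +i* u2 x)%C :> R[i] by [].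
case: (z ord0 x) => a b; rewrite mulN1r -expr2 sqr_complex /= => h.
split; apply: le_lt_trans h; rewrite -sqrtr_sqr ler_wsqrtr//.
  by rewrite lerDl sqr_ge0.
by rewrite lerDr sqr_ge0.
Qed.

Theorem theorem4p21 (R : realType) (X : topologicalType)
  (coecX : co_existentially_closed R X)
  (planarX : exists e : X -> (R * R)%type, topological_embedding e) :
  (forall a : cech_H1 X, a = 0) /\
  (forall e : X -> (R * R)%type, topological_embedding e ->
     ~ separates_plane (range e)).
Proof.
have [[_ cX _] _] := coecX.
have con (e : X -> R * R) : topological_embedding e -> connected (~` range e).
  move=> he; apply: approx_sqrt_complement_connected => // p _ t t0.
  have ce := embedding_continuous he.
  apply: (coec_approx_sqrt coecX) => // x; apply: cvgB; try exact: cvg_cst.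
    by apply: continuous_comp; [exact: ce|exact: cvg_fst].
  by apply: continuous_comp; [exact: ce|exact: cvg_snd].
split; last by move=> e /con ce sep; exact: sep ce.
have [e he] := planarX => a; rewrite -(cech_class_repr a).
by apply/cech_classP; exact: planar_cocycle_trivial (con e he).
Qed.
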